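(* Let $n\ge1$ and let $B\in\mathcal S(\mathbb C^n,\mathbb C)$ satisfy $\log(1-BB^* )\in L^1(\mathbb T)$. Let $a\in\mathcal S(\mathbb C,\mathbb C)$ be an outer function with $\sum_{j=1}^n|b_j(\zeta)|^2+|a(\zeta)|^2=1$ for a.e. $\zeta\in\mathbb T$, and let $A:\mathbb D\to\mathcal L(\mathbb C^n,\mathbb C^n)$ be an outer function with $B(\zeta)^*B(\zeta)+A(\zeta)^*A(\zeta)=I$ for a.e. $\zeta\in\mathbb T$. Then the following are equivalent: (i) $H^\infty\subseteq H(B)$; (ii) $\sup_{m\ge0}\|z^m\|_{H(B)}<\infty$; (iii) $BA^{-1}\in H^2_{\mathcal L(\mathbb C^n,\mathbb C)}$; (iv) $B/a\in H^2_{\mathcal L(\mathbb C^n,\mathbb C)}$; (v) $(1-BB^* )^{-1}\in L^1(\mathbb T)$.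
   Context: $\mathbb D$ is the open unit disc, $\mathbb T$ the unit circle. $\mathcal S(\mathbb C^n,\mathbb C)$ is the set of holomorphic maps $B=(b_1,\dots,b_n):\mathbb D\to\mathcal L(\mathbb C^n,\mathbb C)$ (row vectors) with $\sup_{z\in\mathbb D}\|B(z)\|\le1$; boundary values on $\mathbb T$ are taken a.e. $H(B)$ is the reproducing kernel Hilbert space of functions on $\mathbb D$ with kernel $K_B(z,\lambda)=\frac{1-B(z)B(\lambda)^*}{1-z\bar\lambda}$. $H^\infty$ is the algebra of bounded holomorphic functions on $\mathbb D$. A scalar $a\in H^\infty$ is outer in the usual sense (equivalently, $aH^2$ is dense in $H^2$); a bounded holomorphic $A:\mathbb D\to\mathcal L(\mathbb C^n,\mathbb C^n)$ is outer if $\{Ap: p\text{ a }\mathbb C^n\text{-valued polynomial}\}$ is dense in the Hardy space $H^2_{\mathbb C^n}$ (then $A(z)$ is invertible for $z\in\mathbb D$). $H^2_{\mathcal L(\mathbb C^n,\mathbb C)}$ is the space of holomorphic $F=\sum_j c_jz^j:\mathbb D\to\mathcal L(\mathbb C^n,\mathbb C)$ with $\sum_j\|c_j\|^2<\infty$. *)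

(* Defs.v *)
From HB Require Import structures.
From mathcomp Require Import all_boot all_order all_algebra.
From mathcomp Require Import all_classical all_reals all_analysis.
From mathcomp Require Import complex.

Set Implicit Arguments.
Unset Strict Implicit.
Unset Printing Implicit Defensive.

Import Order.TTheory GRing.Theory Num.Theory.
Local Open Scope ring_scope.
Local Open Scope complex_scope.

Section Defs.
Variable R : realType.
Local Notation C := R[i].

Definition nc2 (z : C) : R := complex.Re z ^+ 2 + complex.Im z ^+ 2.
Definition nc (z : C) : R := Num.sqrt (nc2 z).

Definition inD (z : C) : Prop := nc z < 1.

Definition expi (t : R) : C := cos t +i* sin t.

Definition ps_rep (c : nat -> C) (f : C -> C) : Prop :=
  forall z, inD z -> forall e : R, 0 < e ->
    exists N : nat, forall m : nat, (N <= m)%N ->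
      nc (\sum_(j < m) c j * z ^+ j - f z) < e.

Definition holo (f : C -> C) : Prop := exists c, ps_rep c f.

Definition sqsum (c : nat -> C) : Prop :=
  exists M : R, forall N : nat, \sum_(j < N) nc2 (c j) <= M.

Definition H2 (f : C -> C) : Prop := exists c, ps_rep c f /\ sqsum c.

Definition Hinf (f : C -> C) : Prop :=
  holo f /\ exists M : R, forall z, inD z -> nc (f z) <= M.

Definition radial_lim (f : C -> C) (t : R) (L : C) : Prop :=
  forall e : R, 0 < e -> exists d : R, 0 < d /\
    forall r : R, 1 - d < r -> r < 1 -> nc (f (r%:C * expi t) - L) < e.

Definition schur_row (n : nat) (B : C -> 'rV[C]_n) : Prop :=
  (forall k, holo (fun z => B z 0 k)) /\
  (forall z, inD z -> \sum_(k < n) nc2 (B z 0 k) <= 1).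

Definition schur_scalar (a : C -> C) : Prop :=
  holo a /\ (forall z, inD z -> nc (a z) <= 1).

(* outer scalar function: a bounded holomorphic, and {a p : p polynomial}
   dense in H^2 (H^2 identified with square-summable coefficient sequences) *)
Definition outer_scalar (a : C -> C) : Prop :=
  Hinf a /\
  forall g : nat -> C, sqsum g -> forall e : R, 0 < e ->
    exists (p : {poly C}) (c : nat -> C),
      ps_rep c (fun z => a z * p.[z]) /\
      forall N : nat, \sum_(j < N) nc2 (c j - g j) <= e.

(* outer matrix function: A bounded holomorphic, and {A p : p a C^n-valued
   polynomial} dense in H^2_{C^n} *)
Definition outer_mx (n : nat) (A : C -> 'M[C]_n) : Prop :=
  (forall i j, Hinf (fun z => A z i j)) /\
  forall g : 'I_n -> nat -> C, (forall k, sqsum (g k)) ->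
    forall e : R, 0 < e ->
    exists (p : 'I_n -> {poly C}) (c : 'I_n -> nat -> C),
      (forall k, ps_rep (c k) (fun z => (A z *m \col_l (p l).[z]) k 0)) /\
      forall N : nat, \sum_(k < n) \sum_(j < N) nc2 (c k j - g k j) <= e.

Definition KB (n : nat) (B : C -> 'rV[C]_n) (z l : C) : C :=
  (1 - (B z *m (map_mx conjc (B l))^T) 0 0) / (1 - z * conjc l).

(* f belongs to H(B) with norm <= M : the functional sum_i c_i k_{l_i} |->
   sum_i conj(c_i) f(l_i) is bounded by M on the span of kernel functions *)
Definition inHB_le (n : nat) (B : C -> 'rV[C]_n) (f : C -> C) (M : R) : Prop :=
  forall (m : nat) (lam : 'I_m -> C) (cc : 'I_m -> C),
    (forall i, inD (lam i)) ->
    nc2 (\sum_(i < m) conjc (cc i) * f (lam i)) <=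
      M ^+ 2 * complex.Re (\sum_(i < m) \sum_(j < m)
                             cc i * conjc (cc j) * KB B (lam j) (lam i)).

Definition inHB (n : nat) (B : C -> 'rV[C]_n) (f : C -> C) : Prop :=
  exists M : R, inHB_le B f M.

End Defs.

(* Main.v *)
(* Write [beta] for [B B^*] on the circle.  A function [f] belongs to [H(B)] iff
   [k |-> <f, k>] is bounded on combinations [k] of Szego kernels by the form
   [Q(k) = |k|^2 - |y|^2], [y = T_{B^*} k].

   (v) => (i): pointwise [(1 - beta) |k|^2 <= |k|^2 - 2 Re (conj k B y) + |y|^2],
   and the right-hand side has mean [Q(k)], so Cauchy-Schwarz against the
   integrable weight [1 / (1 - beta)] bounds [|<f, k>| <= |f|_oo * mean |k|].

   (i) => (ii) is the uniform boundedness principle.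

   (ii) => (iii): [Q(k) <= |k - B w|^2 + |w|^2 - |B w|^2] for every polynomial
   vector [w], and kernel combinations are dense, so each coefficient of [B w]
   is at most [M |A w|].  As [A] is outer, [A w] may be replaced by any vector of
   [H^2]; testing the formal quotient [c = B A^-1] against its own reflected
   partial sums gives [|c| <= M].

   (iii) <=> (v), and (iv) <=> (v) by applying the same argument to [a I]:
   [|B x|^2 <= |B A^-1|^2 |A x|^2] at [x = B^*] forces the radial lower limit of
   [|B A^-1|^2] to be at least [beta / (1 - beta)], which is therefore integrable
   by Fatou; conversely the weight [1 / (1 - beta)] bounds the coefficients of
   [B w] by [|A w|] as above. *)
Require Import Defs.
From HB Require Import structures.
From mathcomp Require Import all_boot all_order all_algebra.
From mathcomp Require Import all_classical all_reals all_analysis.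
From mathcomp Require Import complex measurable_realfun.
From mathcomp Require Import ring lra zify.
Set Implicit Arguments.
Unset Strict Implicit.
Unset Printing Implicit Defensive.

Import Order.TTheory GRing.Theory Num.Theory.
Import numFieldNormedType.Exports.
Local Open Scope classical_set_scope.
Local Open Scope ring_scope.
Local Open Scope complex_scope.

(** [H(B)] is never built as a space: membership is a bound on finite kernel combinations, so
    estimates are made on partial sums of Taylor coefficients and then passed to the limit. Two
    objects resist this: [B A^-1], which has no boundary values in advance, and the unbounded weight
    [1 / (1 - beta)]. The first is handled as a formal power series and meets the circle only
    through lower limits along fixed radii; the second is used only as an integrable majorant, in a
    linear inequality with a free parameter. [A] and [a I] share the same lemmas because only
    inequalities on [|A x|] enter. At [x = B^*] both have [|A x|^2 = beta (1 - beta)]: for [A] from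
    [B^* B + A^* A = I], for [a I] from [|a|^2 = 1 - beta]. *)

Local Notation Re := complex.Re.
Local Notation Im := complex.Im.

(** * Modulus, Cauchy-Schwarz and sequential limits of complex numbers *)

Section ComplexModulus.
Variable R : realType.
Local Notation C := R[i].
Implicit Types (x y z w : C) (u v : nat -> C) (e : R).

Lemma norm_nc z : `|z| = (nc z)%:C.
Proof. by rewrite normc_def. Qed.

Lemma nc_ge0 z : 0 <= nc z.
Proof. exact: sqrtr_ge0. Qed.

Lemma nc2_ge0 z : 0 <= nc2 z.
Proof. by rewrite addr_ge0 ?sqr_ge0. Qed.

Lemma nc_sqr z : nc z ^+ 2 = nc2 z.
Proof. by rewrite sqr_sqrtr ?nc2_ge0. Qed.

Lemma ncM z w : nc (z * w) = nc z * nc w.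
Proof. by apply: complexI; rewrite rmorphM/= -!norm_nc normrM. Qed.

Lemma ncD z w : nc (z + w) <= nc z + nc w.
Proof. by rewrite -lecR rmorphD/= -!norm_nc ler_normD. Qed.

Lemma ncN z : nc (- z) = nc z.
Proof. by apply: complexI; rewrite -!norm_nc normrN. Qed.

Lemma nc0 : nc (0 : C) = 0.
Proof. by apply: complexI; rewrite -!norm_nc normr0. Qed.

Lemma nc1 : nc (1 : C) = 1.
Proof. by apply: complexI; rewrite -!norm_nc normr1. Qed.

Lemma ncX z k : nc (z ^+ k) = nc z ^+ k.
Proof. by apply: complexI; rewrite rmorphXn/= -!norm_nc normrX. Qed.

Lemma ncB z w : nc (z - w) <= nc z + nc w.
Proof. by rewrite -[nc w]ncN ncD. Qed.

Lemma nc_distC z w : nc (z - w) = nc (w - z).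
Proof. by rewrite -ncN opprB. Qed.

Lemma nc_conj z : nc (conjc z) = nc z.
Proof. by case: z => a b; rewrite /nc /nc2/= sqrrN. Qed.

Lemma nc_real (r : R) : nc r%:C = `|r|.
Proof. by rewrite /nc /nc2/= expr0n/= addr0 sqrtr_sqr. Qed.

Lemma nc_eq0 z : (nc z == 0) = (z == 0).
Proof. by rewrite -[z == 0]normr_eq0 norm_nc -(inj_eq (@complexI R)). Qed.

Lemma nc_expi (t : R) : nc (expi t) = 1.
Proof. by rewrite /nc /nc2/= cos2Dsin2 sqrtr1. Qed.

Lemma nc_sum (I : Type) (r : seq I) (P : pred I) (F : I -> C) :
  nc (\sum_(i <- r | P i) F i) <= \sum_(i <- r | P i) nc (F i).
Proof.
elim/big_ind2: _ => [|x1 x2 y1 y2 h1 h2|//]; first by rewrite nc0.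
by apply: le_trans (ncD _ _) _; rewrite lerD.
Qed.

Lemma Re_nc z : `|Re z| <= nc z.
Proof. by rewrite -[leLHS]sqrtr_sqr ler_sqrt ?nc2_ge0// lerDl sqr_ge0. Qed.

Lemma Im_nc z : `|Im z| <= nc z.
Proof. by rewrite -[leLHS]sqrtr_sqr ler_sqrt ?nc2_ge0// lerDr sqr_ge0. Qed.

Lemma Re_le_nc z : Re z <= nc z.
Proof. exact: le_trans (ler_norm _) (Re_nc z). Qed.

Lemma nc_ReIm z : nc z <= `|Re z| + `|Im z|.
Proof.
rewrite -[leRHS]ger0_norm ?addr_ge0// -sqrtr_sqr ler_sqrt ?sqr_ge0//.
rewrite sqrrD !real_normK ?num_real// addrAC lerDl.
by rewrite mulrn_wge0 // mulr_ge0.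
Qed.

Lemma nc2M z w : nc2 (z * w) = nc2 z * nc2 w.
Proof. by rewrite -!nc_sqr ncM exprMn. Qed.

Lemma nc2N z : nc2 (- z) = nc2 z.
Proof. by rewrite -!nc_sqr ncN. Qed.

Lemma nc2_conj z : nc2 (conjc z) = nc2 z.
Proof. by rewrite -!nc_sqr nc_conj. Qed.

Lemma nc20 : nc2 (0 : C) = 0.
Proof. by rewrite -nc_sqr nc0 expr0n. Qed.

Lemma nc2_real (r : R) : nc2 r%:C = r ^+ 2.
Proof. by rewrite /nc2/= expr0n addr0. Qed.

Lemma nc2_conjM z : z * conjc z = (nc2 z)%:C.
Proof. by rewrite -sqr_normc norm_nc -rmorphXn/= nc_sqr. Qed.

Lemma nc2E z : nc2 z = Re (z * conjc z).
Proof. by rewrite nc2_conjM. Qed.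

Lemma Re_mulJC z w : Re (z * conjc w) = Re (w * conjc z).
Proof. by case: z w => [a b] [c d]/=; ring. Qed.

Lemma nc2D z w : nc2 (z + w) = nc2 z + 2 * Re (z * conjc w) + nc2 w.
Proof. by case: z w => [a b] [c d]; rewrite /nc2/=; ring. Qed.

Lemma nc2B z w : nc2 (z - w) = nc2 z - 2 * Re (z * conjc w) + nc2 w.
Proof. by case: z w => [a b] [c d]; rewrite /nc2/=; ring. Qed.

Lemma Re_realM (r : R) z : Re (r%:C * z) = r * Re z.
Proof. by case: z => a b/=; ring. Qed.

Lemma Re_add z w : Re (z + w) = Re z + Re w. Proof. by case: z w => [? ?] []. Qed.
Lemma Im_add z w : Im (z + w) = Im z + Im w. Proof. by case: z w => [? ?] []. Qed.
Lemma Re_opp z : Re (- z) = - Re z. Proof. by case: z. Qed.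
Lemma Im_opp z : Im (- z) = - Im z. Proof. by case: z. Qed.
Lemma Re_sub z w : Re (z - w) = Re z - Re w. Proof. by rewrite Re_add Re_opp. Qed.
Lemma Re_mul z w : Re (z * w) = Re z * Re w - Im z * Im w.
Proof. by case: z w => [? ?] []. Qed.
Lemma Im_mul z w : Im (z * w) = Re z * Im w + Im z * Re w.
Proof. by case: z w => [? ?] []. Qed.
Lemma Re_conjc z : Re (conjc z) = Re z. Proof. by case: z. Qed.
Lemma Im_conjc z : Im (conjc z) = - Im z. Proof. by case: z. Qed.

Lemma Re_sum (I : Type) (r : seq I) (P : pred I) (F : I -> C) :
  Re (\sum_(i <- r | P i) F i) = \sum_(i <- r | P i) Re (F i).
Proof. by apply: (big_morph (@Re R)) => //; exact: Re_add. Qed.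

Lemma Im_sum (I : Type) (r : seq I) (P : pred I) (F : I -> C) :
  Im (\sum_(i <- r | P i) F i) = \sum_(i <- r | P i) Im (F i).
Proof. by apply: (big_morph (@Im R)) => //; exact: Im_add. Qed.

Lemma conjc_sum (I : Type) (r : seq I) (P : pred I) (F : I -> C) :
  conjc (\sum_(i <- r | P i) F i) = \sum_(i <- r | P i) conjc (F i).
Proof. exact: rmorph_sum. Qed.

(** Expanding [\sum_i |X y_i - s conj (x_i)|^2 >= 0] gives [X (X Y - |s|^2) >= 0]; when [X = 0] all
    [x_i] vanish. *)
Lemma nc2_sumM_le (I : finType) (x y : I -> C) :
  nc2 (\sum_i x i * y i) <= (\sum_i nc2 (x i)) * (\sum_i nc2 (y i)).
Proof.
set X := \sum_i nc2 (x i); set Y := \sum_i nc2 (y i).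
set s := \sum_i x i * y i.
have X0 : 0 <= X by apply: sumr_ge0 => i _; exact: nc2_ge0.
have [X_eq0|X_neq0] := eqVneq X 0.
  have x0 i : x i = 0.
    have /eqP := X_eq0; rewrite psumr_eq0; last by move=> ? _; exact: nc2_ge0.
    by move/allP/(_ i (mem_index_enum _)) => /=; rewrite -nc_sqr sqrf_eq0 nc_eq0 => /eqP.
  by rewrite /s big1 ?nc20 ?X_eq0 ?mul0r// => i _; rewrite x0 mul0r.
have : 0 <= \sum_i nc2 (X%:C * y i - s * conjc (x i)).
  by apply: sumr_ge0 => i _; exact: nc2_ge0.
under eq_bigr => i _.
  rewrite nc2B nc2M nc2_real nc2M nc2_conj -mulrA Re_realM.
  rewrite (_ : y i * _ = conjc s * (x i * y i)); last first.
    by rewrite rmorphM/= conjcK; ring.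
  rewrite addrC.
  over.
rewrite big_split/= sumrB -!mulr_sumr -/X -/Y -Re_sum -mulr_sumr -/s.
rewrite [_ * s]mulrC -nc2E.
set S := nc2 s => h.
have : 0 <= X * (X * Y - S) by lra.
by rewrite pmulr_rge0 ?subr_ge0// lt_neqAle eq_sym X_neq0.
Qed.

(** Same epsilon form as [ps_rep] and [radial_lim], so these apply without conversion; [cto_ReIm]
    transports it to real filters. *)
Definition cto u (l : C) := forall e : R, 0 < e ->
  exists N : nat, forall m : nat, (N <= m)%N -> nc (u m - l) < e.

Lemma cto_ReIm u l : cto u l <->
  (Re (u n) @[n --> \oo] --> Re l) /\ (Im (u n) @[n --> \oo] --> Im l).
Proof.
split=> [h|[hr hi] e e0].
  by split; apply/cvgrPdist_lt => e /h[N hN]; exists N => // m /= /hN;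
    apply: le_lt_trans; rewrite nc_distC; [rewrite -Re_sub Re_nc|rewrite -Im_opp -Im_add Im_nc].
have e20 : 0 < e / 2 by rewrite divr_gt0.
move/cvgrPdist_lt : hr => /(_ _ e20)[N1 _ h1].
move/cvgrPdist_lt : hi => /(_ _ e20)[N2 _ h2].
exists (maxn N1 N2) => m; rewrite geq_max => /andP[m1 m2].
rewrite nc_distC; apply: le_lt_trans (nc_ReIm _) _.
rewrite Re_sub Im_add Im_opp [ltRHS]splitr.
by apply: ltrD; [exact: h1|exact: h2].
Qed.

Lemma cto_cst z : cto (fun=> z) z.
Proof. by move=> e e0; exists 0%N => m _; rewrite subrr nc0. Qed.

Lemma cto_ext u v l : (exists N, forall m, (N <= m)%N -> u m = v m) ->
  cto u l -> cto v l.
Proof.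
move=> [N h] H e /H[N' h']; exists (maxn N N') => m; rewrite geq_max => /andP[m1 m2].
by rewrite -h// h'.
Qed.

Lemma ctoD u v l m : cto u l -> cto v m -> cto (fun n => u n + v n) (l + m).
Proof.
move=> /cto_ReIm[h1 h2] /cto_ReIm[h3 h4]; apply/cto_ReIm; split.
  rewrite Re_add (_ : (fun n => _) = (fun n => Re (u n) + Re (v n))); first exact: cvgD.
  by apply/funext => n; rewrite Re_add.
rewrite Im_add (_ : (fun n => _) = (fun n => Im (u n) + Im (v n))); first exact: cvgD.
by apply/funext => n; rewrite Im_add.
Qed.

Lemma ctoM u v l m : cto u l -> cto v m -> cto (fun n => u n * v n) (l * m).
Proof.
move=> /cto_ReIm[h1 h2] /cto_ReIm[h3 h4]; apply/cto_ReIm; split.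
  rewrite Re_mul (_ : (fun n => _) = (fun n => Re (u n) * Re (v n) - Im (u n) * Im (v n))).
    by apply: cvgB; exact: cvgM.
  by apply/funext => n/=; rewrite Re_mul.
rewrite Im_mul (_ : (fun n => _) = (fun n => Re (u n) * Im (v n) + Im (u n) * Re (v n))).
  by apply: cvgD; exact: cvgM.
by apply/funext => n/=; rewrite Im_mul.
Qed.

Lemma ctoZ z u l : cto u l -> cto (fun n => z * u n) (z * l).
Proof. exact/ctoM/cto_cst. Qed.

Lemma ctoN u l : cto u l -> cto (fun n => - u n) (- l).
Proof.
move=> h; rewrite -mulN1r (_ : (fun n => _) = (fun n => -1 * u n)); first exact: ctoZ.
by apply/funext => n; rewrite mulN1r.
Qed.

Lemma ctoB u v l m : cto u l -> cto v m -> cto (fun n => u n - v n) (l - m).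
Proof. by move=> h1 /ctoN; exact: ctoD. Qed.

Lemma cto_conj u l : cto u l -> cto (fun n => conjc (u n)) (conjc l).
Proof.
by move=> h e /h[N hN]; exists N => m /hN; rewrite -rmorphB/= nc_conj.
Qed.

Lemma cto_sum (I : Type) (r : seq I) (P : pred I) (F : I -> nat -> C) (l : I -> C) :
  (forall i, P i -> cto (F i) (l i)) ->
  cto (fun n => \sum_(i <- r | P i) F i n) (\sum_(i <- r | P i) l i).
Proof.
move=> h; elim: r => [|i r IH].
  by rewrite big_nil; apply: (cto_ext _ (cto_cst 0)); exists 0%N => m _; rewrite big_nil.
rewrite big_cons; case: ifPn => Pi.
  apply: (cto_ext _ (ctoD (h i Pi) IH)); exists 0%N => m _; by rewrite big_cons Pi.
by apply: (cto_ext _ IH); exists 0%N => m _; rewrite big_cons (negbTE Pi).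
Qed.

Lemma cto_Re u l : cto u l -> Re (u n) @[n --> \oo] --> Re l.
Proof. by move=> /cto_ReIm[]. Qed.

Lemma cto_nc2 u l : cto u l -> nc2 (u n) @[n --> \oo] --> nc2 l.
Proof.
move=> h; rewrite nc2E (_ : (fun n => _) = (fun n => Re (u n * conjc (u n)))).
  exact: (cto_Re (ctoM h (cto_conj h))).
by apply/funext => n; rewrite nc2E.
Qed.

Lemma cto_nc u l : cto u l -> nc (u n) @[n --> \oo] --> nc l.
Proof.
by move=> /cto_nc2 h; exact: (cvg_comp _ _ h (@sqrt_continuous R (nc2 l))).
Qed.

Lemma cto_unique u l m : cto u l -> cto u m -> l = m.
Proof.
move=> /cto_ReIm[h1 h2] /cto_ReIm[h3 h4].
have := cvg_unique _ h1 h3; have := cvg_unique _ h2 h4.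
by case: l m {h1 h2 h3 h4} => [a b] [c d] /= -> // ->.
Qed.

Lemma cto_nc_le u l (M : R) : cto u l -> (forall n, nc (u n) <= M) -> nc l <= M.
Proof.
move=> /cto_nc h hM; rewrite -(cvg_lim _ h)//.
by apply: limr_le; [apply/cvg_ex; eexists; exact: h|exact: nearW].
Qed.

Lemma cto_subseq u l (s : nat -> nat) : (forall n, (n <= s n)%N) ->
  cto u l -> cto (u \o s) l.
Proof.
by move=> hs h e /h[N hN]; exists N => m Nm /=; apply: hN; exact: leq_trans (hs m).
Qed.

Lemma cto_squeeze u l (b : nat -> R) : (forall n, nc (u n - l) <= b n) ->
  b @ \oo --> (0 : R) -> cto u l.
Proof.
move=> h hb e e0; move/cvgrPdist_lt : hb => /(_ _ e0)[N _ hN].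
exists N => m /hN; rewrite sub0r normrN; apply: le_lt_trans.
exact: le_trans (h m) (ler_norm _).
Qed.

Lemma cvgr_sum (I : Type) (r : seq I) (F : I -> nat -> R) (l : I -> R) :
  (forall i, F i @ \oo --> l i) ->
  \sum_(i <- r) F i n @[n --> \oo] --> \sum_(i <- r) l i.
Proof.
move=> h; elim: r => [|i r IH].
  by rewrite big_nil; under eq_fun do rewrite big_nil; exact: cvg_cst.
by rewrite big_cons; under eq_fun do rewrite big_cons; exact: cvgD.
Qed.

End ComplexModulus.

(** * Power series in the disc: geometric decay, tails, Cauchy products *)

Section PowerSeries.
Variable R : realType.
Local Notation C := R[i].
Implicit Types (z w : C) (c d : nat -> C) (f g : C -> C) (r s M : R).

Definition psum c z (m : nat) : C := \sum_(j < m) c j * z ^+ j.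

Lemma psum_sum (I : Type) (l : seq I) (P : pred I) (c : I -> nat -> C) z m :
  psum (fun j => \sum_(k <- l | P k) c k j) z m = \sum_(k <- l | P k) psum (c k) z m.
Proof.
by rewrite /psum exchange_big/=; apply: eq_bigr => j _; rewrite mulr_suml.
Qed.

Lemma inD_circle r (t : R) : 0 <= r -> r < 1 -> inD (r%:C * expi t).
Proof. by move=> r0 r1; rewrite /inD ncM nc_expi mulr1 nc_real ger0_norm. Qed.

Lemma nc_circle r (t : R) : 0 <= r -> nc (r%:C * expi t) = r.
Proof. by move=> r0; rewrite ncM nc_expi mulr1 nc_real ger0_norm. Qed.

Lemma ps_cto c f z : ps_rep c f -> inD z -> cto (psum c z) (f z).
Proof. by move=> h /h. Qed.

Lemma ps_ext c f g : (forall z, inD z -> f z = g z) -> ps_rep c f -> ps_rep c g.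
Proof. by move=> fg h z zD; rewrite -fg//; exact: h. Qed.

Lemma ps_coef_ext c d f : c =1 d -> ps_rep c f -> ps_rep d f.
Proof. by move=> /funext->. Qed.

Lemma cto_bounded (u : nat -> C) l : cto u l -> exists2 M, 0 < M & forall n, nc (u n) <= M.
Proof.
move=> /(_ 1 ltr01)[N hN]; exists (\sum_(n < N) nc (u n) + (nc l + 1)).
  rewrite ltr_wpDl ?sumr_ge0// ?ltr_wpDl ?nc_ge0// => i _; exact: nc_ge0.
move=> n; have [nN|Nn] := ltnP n N.
  rewrite (bigD1 (Ordinal nN))//= -addrA lerDl addr_ge0 ?addr_ge0 ?nc_ge0//.
  by apply: sumr_ge0 => i _; exact: nc_ge0.
rewrite -[u n](subrK l) (le_trans (ncD _ _))// addrC.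
rewrite (@le_trans _ _ (nc l + 1))// ?lerD2l ?(ltW (hN _ Nn))// lerDr.
by apply: sumr_ge0 => i _; exact: nc_ge0.
Qed.

Lemma ps_bound c f r : ps_rep c f -> 0 <= r -> r < 1 ->
  exists2 M, 0 < M & forall j, nc (c j) * r ^+ j <= M.
Proof.
move=> cf r0 r1.
have rD : inD r%:C by rewrite /inD nc_real ger0_norm.
have [M M0 hM] := cto_bounded (ps_cto cf rD).
exists (M + M); first by rewrite addr_gt0.
move=> j; rewrite -[X in _ * X ^+ _](ger0_norm r0) -nc_real -ncX -ncM.
rewrite (_ : c j * _ = psum c r%:C j.+1 - psum c r%:C j).
  by rewrite (le_trans (ncB _ _))// lerD.
by rewrite /psum big_ord_recr/= addrAC subrr add0r.
Qed.

(** Convergence at a radius [q] between [r] and 1 bounds [c_j q^j], and the ratio [r / q < 1]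
    supplies the decay. *)
Lemma ps_geo c f r : ps_rep c f -> 0 <= r -> r < 1 ->
  exists M s, [/\ 0 < M, 0 <= s, s < 1 & forall j, nc (c j) * r ^+ j <= M * s ^+ j].
Proof.
move=> cf r0 r1; pose q := (1 + r) / 2.
have q0 : 0 < q by rewrite /q; lra.
have q1 : q < 1 by rewrite /q; lra.
have rq : r < q by rewrite /q; lra.
have [M M0 hM] := ps_bound cf (ltW q0) q1.
exists M, (r / q); split => //; first by rewrite divr_ge0// ltW.
  by rewrite ltr_pdivrMr// mul1r.
move=> j; have -> : r ^+ j = q ^+ j * (r / q) ^+ j by rewrite -exprMn mulrC divfK ?gt_eqF.
rewrite mulrA.
by rewrite ler_wpM2r ?hM// exprn_ge0// divr_ge0// ltW.
Qed.

Lemma geo_sum s m : 0 <= s -> s < 1 -> \sum_(j < m) s ^+ j <= (1 - s)^-1.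
Proof.
move=> s0 s1; have := subrX1 s m; rewrite -opprB -[s - 1]opprB mulNr.
move=> /oppr_inj h; rewrite -[leRHS]mul1r ler_pdivlMr ?subr_gt0// mulrC -h.
by rewrite lerBlDr lerDl exprn_ge0.
Qed.

Lemma psum_tail c M s r z m m' : 0 <= M -> 0 <= s -> s < 1 -> nc z <= r ->
  (forall j, nc (c j) * r ^+ j <= M * s ^+ j) -> (m <= m')%N ->
  nc (psum c z m' - psum c z m) <= M * s ^+ m / (1 - s).
Proof.
move=> M0 s0 s1 zr h mm'.
rewrite /psum -!(big_mkord xpredT (fun j => c j * z ^+ j)).
rewrite (big_cat_nat (n := m))//= addrAC subrr add0r -{1}[m]add0n big_addn big_mkord.
apply: le_trans (nc_sum _ _ _) _.
apply: (@le_trans _ _ (\sum_(i < m' - m) M * s ^+ m * s ^+ i)).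
  apply: ler_sum => i _; rewrite ncM ncX -mulrA -exprD addnC.
  apply: le_trans (h _); rewrite ler_wpM2l ?nc_ge0//.
  by rewrite lerXn2r// nnegrE ?nc_ge0// (le_trans (nc_ge0 z)).
rewrite -mulr_sumr ler_wpM2l ?geo_sum//.
by rewrite mulr_ge0// exprn_ge0.
Qed.

Lemma psum_bound c M s r z m : 0 <= M -> 0 <= s -> s < 1 -> nc z <= r ->
  (forall j, nc (c j) * r ^+ j <= M * s ^+ j) ->
  nc (psum c z m) <= M / (1 - s).
Proof.
move=> M0 s0 s1 zr h; have := psum_tail M0 s0 s1 zr h (leq0n m).
by rewrite [psum c z 0]/psum big_ord0 subr0 expr0 mulr1.
Qed.

Lemma ps_tail c f M s r z m : ps_rep c f -> inD z -> 0 <= M -> 0 <= s -> s < 1 ->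
  nc z <= r -> (forall j, nc (c j) * r ^+ j <= M * s ^+ j) ->
  nc (psum c z m - f z) <= M * s ^+ m / (1 - s).
Proof.
move=> cf zD M0 s0 s1 zr h; rewrite nc_distC.
have : cto (fun n => psum c z (m + n) - psum c z m) (f z - psum c z m).
  apply: ctoB (cto_cst _).
  by apply: (cto_subseq (s := addn m)) (ps_cto cf zD) => n; exact: leq_addl.
by move/cto_nc_le; apply => n; apply: psum_tail zr h _ => //; exact: leq_addr.
Qed.

Lemma csum_cvg (u : nat -> C) (v : nat -> R) : (forall j, nc (u j) <= v j) ->
  cvgn (series v) -> exists l, cto (fun m => \sum_(j < m) u j) l.
Proof.
move=> uv cv.
have cR (p : C -> R) : (forall z, `|p z| <= nc z) -> cvgn (series (p \o u)).
  move=> hp; apply: normed_cvg; apply: (series_le_cvg _ _ _ cv) => n//=.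
    exact: le_trans (nc_ge0 _) (uv n).
  exact: le_trans (hp _) (uv n).
have cr := cR _ (@Re_nc R); have ci := cR _ (@Im_nc R).
exists (limn (series ((fun z => Re z) \o u)) +i* limn (series ((fun z => Im z) \o u))).
apply/cto_ReIm; split => /=.
  rewrite (_ : (fun n => _) = series ((fun z => Re z) \o u)); first exact: cr.
  by apply/funext => n; rewrite Re_sum seriesEord.
rewrite (_ : (fun n => _) = series ((fun z => Im z) \o u)); first exact: ci.
by apply/funext => n; rewrite Im_sum seriesEord.
Qed.

Lemma ps_exists c M : (forall j, nc (c j) <= M) -> exists f, ps_rep c f.
Proof.
move=> hM; have H z : exists l, inD z -> cto (psum c z) l.
  have [zD|zD] := pselect (inD z); last by exists 0.
  have [||l hl] := @csum_cvg (fun j => c j * z ^+ j) (geometric M (nc z)).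
  - by move=> j; rewrite ncM ncX ler_wpM2r// exprn_ge0// nc_ge0.
  - by apply: is_cvg_geometric_series; rewrite ger0_norm ?nc_ge0.
  - by exists l.
by have [f hf] := choice H; exists f => z; exact: hf.
Qed.

Lemma expr_cvg0 s : 0 <= s -> s < 1 -> (fun n => s ^+ n) @ \oo --> (0 : R).
Proof. by move=> s0 s1; apply: cvg_expr; rewrite ger0_norm. Qed.

(** With [q = sqrt s], [n q^n] is at most a geometric sum, hence [n s^n] is at most a constant times
    [q^n]. *)
Lemma natM_expr_cvg0 s : 0 <= s -> s < 1 -> (fun n => n%:R * s ^+ n) @ \oo --> (0 : R).
Proof.
move=> s0 s1; pose q := Num.sqrt s.
have q0 : 0 <= q by exact: sqrtr_ge0.
have q1 : q < 1 by rewrite -(sqrtr1 R) ltr_sqrt.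
have sq : s = q * q by rewrite -expr2 sqr_sqrtr.
apply: (@squeeze_cvgr _ _ _ _ (fun=> 0) (fun n => (1 - q)^-1 * q ^+ n)).
- apply: nearW => n; rewrite mulr_ge0 ?exprn_ge0//=.
  rewrite sq exprMn mulrA ler_wpM2r ?exprn_ge0//.
  apply: le_trans (geo_sum n q0 q1); rewrite -[X in X%:R * _](card_ord n).
  rewrite -sum1_card natr_sum mulr_suml; apply: ler_sum => i _; rewrite mul1r.
  by apply: ler_wiXn2l => //; [exact: ltW|exact: ltnW].
- exact: cvg_cst.
- by rewrite -[X in _ --> X](mulr0 (1 - q)^-1); apply: cvgMr; exact: expr_cvg0.
Qed.

Definition conv c d (m : nat) : C := \sum_(j < m.+1) c j * d (m - j)%N.

Lemma sum_conv c d N :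
  \sum_(m < N) conv c d m = \sum_(i < N) c i * \sum_(j < N - i) d j.
Proof.
elim: N => [|N IH]; first by rewrite !big_ord0.
rewrite big_ord_recr/= IH [RHS]big_ord_recr/= subSnn big_ord_recr big_ord0/= add0r.
rewrite /conv big_ord_recr/= subnn addrA; congr (_ + _).
rewrite -big_split/=; apply: eq_bigr => i _.
by rewrite subSn 1?ltnW// big_ord_recr/= mulrDr.
Qed.

Lemma conv_psum c d z N :
  psum (conv c d) z N = \sum_(i < N) c i * z ^+ i * psum d z (N - i).
Proof.
rewrite /psum -(sum_conv (fun j => c j * z ^+ j) (fun j => d j * z ^+ j)).
apply: eq_bigr => m _; rewrite mulr_suml; apply: eq_bigr => j _.
rewrite mulrACA -exprD subnKC ?mulrA//.
by have := ltn_ord j; rewrite ltnS.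
Qed.

(** The defect between [psum (conv c d) z N] and [psum c z N * g z] is a sum of [N] tails, each
    [O(s^N)] by the decay of both factors, so it is [O(N s^N)]. *)
Lemma ps_mul c d f g : ps_rep c f -> ps_rep d g ->
  ps_rep (conv c d) (fun z => f z * g z).
Proof.
move=> cf dg z zD.
have [M1 [s1 [M10 s10 s11 h1]]] := ps_geo cf (nc_ge0 z) zD.
have [M2 [s2 [M20 s20 s21 h2]]] := ps_geo dg (nc_ge0 z) zD.
pose s := Num.max s1 s2.
have s0 : 0 <= s by rewrite le_max s10.
have s_lt1 : s < 1 by rewrite gt_max s11.
have h2' j : nc (d j) * nc z ^+ j <= M2 * s ^+ j.
  apply: le_trans (h2 j) _; rewrite ler_wpM2l ?(ltW M20) ?(ltW M10)// lerXn2r ?nnegrE//.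
  by rewrite le_max lexx orbT.
have h1' j : nc (c j) * nc z ^+ j <= M1 * s ^+ j.
  apply: le_trans (h1 j) _; rewrite ler_wpM2l ?(ltW M20) ?(ltW M10)// lerXn2r ?nnegrE//.
  by rewrite le_max lexx.
pose K := M1 * M2 / (1 - s).
suff : cto (fun N => psum (conv c d) z N - psum c z N * g z) 0.
  move=> /(ctoD (ctoM (ps_cto cf zD) (cto_cst (g z)))); rewrite addr0 => H.
  have := cto_ext (v := psum (conv c d) z) _ H; apply.
  by exists 0%N => m _; rewrite addrC subrK.
apply: (@cto_squeeze _ _ _ (fun N => K * (N%:R * s ^+ N))) => [N|].
  rewrite subr0 conv_psum /psum mulr_suml -sumrB.
  apply: le_trans (nc_sum _ _ _) _.
  apply: (@le_trans _ _ (\sum_(i < N) K * s ^+ N)).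
    apply: ler_sum => i _; rewrite -mulrBr !ncM ncX.
    have iN : (i <= N)%N by rewrite ltnW.
    apply: (@le_trans _ _ (M1 * s ^+ i * (M2 * s ^+ (N - i) / (1 - s)))).
      apply: ler_pM; rewrite ?mulr_ge0 ?exprn_ge0 ?nc_ge0 ?h1'//.
      by apply: ps_tail h2' => //; rewrite ltW.
    have -> : s ^+ N = s ^+ i * s ^+ (N - i) by rewrite -exprD subnKC.
    by rewrite /K le_eqVlt; apply/orP; left; apply/eqP; ring.
  by rewrite sumr_const card_ord -[leLHS]mulr_natl mulrCA.
rewrite -[X in _ --> X](mulr0 K); apply: cvgMr.
exact: natM_expr_cvg0.
Qed.

Lemma ps_poly (p : {poly C}) : ps_rep (fun j => p`_j) (horner p).
Proof.
move=> z _; apply: cto_ext (cto_cst _); exists (size p) => m sm.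
by rewrite (horner_coef_wide _ sm).
Qed.

Lemma ps_sum (I : Type) (l : seq I) (P : pred I) (c : I -> nat -> C) (f : I -> C -> C) :
  (forall k, P k -> ps_rep (c k) (f k)) ->
  ps_rep (fun j => \sum_(k <- l | P k) c k j) (fun z => \sum_(k <- l | P k) f k z).
Proof.
move=> h z zD; have := @cto_sum R I l P (fun k => psum (c k) z) (fun k => f k z).
move=> /(_ (fun k Pk => ps_cto (h k Pk) zD)).
by apply: cto_ext; exists 0%N => m _; rewrite -psum_sum.
Qed.

Lemma ps_sub c d f g : ps_rep c f -> ps_rep d g ->
  ps_rep (fun j => c j - d j) (fun z => f z - g z).
Proof.
move=> cf dg z zD; have := ctoB (ps_cto cf zD) (ps_cto dg zD).
apply: cto_ext; exists 0%N => m _; rewrite -sumrB.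
by apply: eq_bigr => j _; rewrite mulrBl.
Qed.

End PowerSeries.

(** * Normalized means over the circle and orthogonality of exponentials *)

Section CircleMean.
Variable R : realType.
Local Notation C := R[i].
Local Notation mu := (@lebesgue_measure R).
Local Notation T := `[0, 2 * pi]%classic.
Implicit Types (f g : R -> R) (F G : R -> C) (c d : nat -> C).

Lemma twopi_gt0 : 0 < 2 * pi :> R.
Proof. by rewrite mulr_gt0// pi_gt0. Qed.

Lemma measurable_circle : measurable (T : set R).
Proof. exact: measurable_itv. Qed.
Hint Resolve measurable_circle : core.

Lemma measure_circle : mu T = (2 * pi)%:E.
Proof.
by rewrite lebesgue_measure_itv/= lte_fin twopi_gt0 -EFinB subr0.
Qed.

Let aeF := ae_filter_ringOfSetsType mu.

Definition ae_circle (P : R -> Prop) :=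
  {ae mu, forall t, t \in `[0, 2 * pi] -> P t}.

Lemma ae_circleW (P : R -> Prop) : (forall t, P t) -> ae_circle P.
Proof. by move=> h; apply: aeW => t _; exact: h. Qed.

Lemma ae_circleS (P Q : R -> Prop) : (forall t, P t -> Q t) -> ae_circle P -> ae_circle Q.
Proof. by rewrite /ae_circle => h; apply: (@filterS _ _ aeF) => t Pt /Pt; exact: h. Qed.

Lemma ae_circleI (P Q : R -> Prop) : ae_circle P -> ae_circle Q ->
  ae_circle (fun t => P t /\ Q t).
Proof. by rewrite /ae_circle; apply: (@filterS2 _ _ aeF) => t Pt Qt tT; split; [exact: Pt|exact: Qt]. Qed.

(* Bounded almost everywhere only: boundary values are controlled just a.e. *)
Definition bmf f := measurable_fun T f /\ exists M : R, ae_circle (fun t => `|f t| <= M).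

Definition bmfC F := bmf (fun t => Re (F t)) /\ bmf (fun t => Im (F t)).

Definition cmean f : R := (2 * pi)^-1 * (\int[mu]_(t in T) f t).

Lemma bmf_cst (x : R) : bmf (fun=> x).
Proof. by split; [exact: measurable_cst|exists `|x|; exact: ae_circleW]. Qed.

Lemma bmfD f g : bmf f -> bmf g -> bmf (fun t => f t + g t).
Proof.
move=> [mf [M hM]] [mg [N hN]]; split; first exact: measurable_funD.
exists (M + N); apply: ae_circleS (ae_circleI hM hN) => t [h1 h2].
by rewrite (le_trans (ler_normD _ _))// lerD.
Qed.

Lemma bmfM f g : bmf f -> bmf g -> bmf (fun t => f t * g t).
Proof.
move=> [mf [M hM]] [mg [N hN]]; split; first exact: measurable_funM.
exists (M * N); apply: ae_circleS (ae_circleI hM hN) => t [h1 h2].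
by rewrite normrM ler_pM.
Qed.

Lemma bmfN f : bmf f -> bmf (fun t => - f t).
Proof.
move=> [mf [M hM]]; split; first exact: measurable_funN.
by exists M; apply: ae_circleS hM => t; rewrite normrN.
Qed.

Lemma bmfB f g : bmf f -> bmf g -> bmf (fun t => f t - g t).
Proof. by move=> hf hg; apply: bmfD => //; exact: bmfN. Qed.

Lemma bmf_sum (I : Type) (r : seq I) (f : I -> R -> R) :
  (forall i, bmf (f i)) -> bmf (fun t => \sum_(i <- r) f i t).
Proof.
move=> h; elim: r => [|i r IH].
  by under eq_fun do rewrite big_nil; exact: bmf_cst.
by under eq_fun do rewrite big_cons; exact: bmfD.
Qed.

Lemma bmf_min f g : bmf f -> bmf g -> bmf (fun t => Num.min (f t) (g t)).
Proof.
move=> [mf [M hM]] [mg [N hN]]; split; first exact: measurable_minr.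
exists (Num.max M N); apply: ae_circleS (ae_circleI hM hN) => t [h1 h2].
by rewrite le_max; have [_|_] := leP (f t) (g t); rewrite ?h1// h2 orbT.
Qed.

Lemma bmf_integrable f : bmf f -> mu.-integrable T (EFin \o f).
Proof.
move=> [mf [M hM]]; apply/integrableP; split; first exact/measurable_EFinP.
apply: (@le_lt_trans _ _ (\int[mu]_(t in T) (`|M|%:E))%E).
  apply: ae_ge0_le_integral => //.
  - by apply/measurable_EFinP; apply: measurableT_comp.
  - move: hM; apply: (@filterS _ _ aeF) => t h tT /=; rewrite lee_fin.
    exact: le_trans (h tT) (ler_norm _).
by rewrite integral_cst// [X in (_ * X)%E]measure_circle -EFinM ltry.
Qed.

Lemma cmeanD f g : bmf f -> bmf g -> cmean (fun t => f t + g t) = cmean f + cmean g.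
Proof. by move=> hf hg; rewrite /cmean RintegralD; [exact: mulrDr| |exact: bmf_integrable..]. Qed.

Lemma cmeanZ (x : R) f : bmf f -> cmean (fun t => x * f t) = x * cmean f.
Proof. by move=> hf; rewrite /cmean RintegralZl; [exact: mulrCA| |exact: bmf_integrable]. Qed.

Lemma cmeanN f : bmf f -> cmean (fun t => - f t) = - cmean f.
Proof.
move=> hf; rewrite -mulN1r -cmeanZ//; congr cmean.
by apply/funext => t; rewrite mulN1r.
Qed.

Lemma cmeanB f g : bmf f -> bmf g -> cmean (fun t => f t - g t) = cmean f - cmean g.
Proof. by move=> hf hg; rewrite cmeanD ?cmeanN//; exact: bmfN. Qed.

Lemma cmean_cst (x : R) : cmean (fun=> x) = x.
Proof.
by rewrite /cmean Rintegral_cst// [X in fine X]measure_circle/= mulrC mulfK// gt_eqF// twopi_gt0.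
Qed.

Lemma cmean_sum (I : Type) (r : seq I) (f : I -> R -> R) :
  (forall i, bmf (f i)) -> cmean (fun t => \sum_(i <- r) f i t) = \sum_(i <- r) cmean (f i).
Proof.
move=> h; elim: r => [|i r IH].
  by under eq_fun do rewrite big_nil; rewrite cmean_cst big_nil.
by under eq_fun do rewrite big_cons; rewrite cmeanD ?IH ?big_cons//; exact: bmf_sum.
Qed.

Lemma cmean_ge0 f : bmf f -> ae_circle (fun t => 0 <= f t) -> 0 <= cmean f.
Proof.
move=> hf f0; rewrite /cmean mulr_ge0 ?invr_ge0 ?(ltW twopi_gt0)//.
have mf : measurable_fun T (EFin \o f) by apply/measurable_EFinP; case: hf.
(* The sign is known only almost everywhere, so the integrand is exchanged for its absolute
   value. *)
rewrite /Rintegral (@ae_eq_integral _ _ _ mu T (fun t => `|(f t)%:E|)%E)//.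
- by rewrite fine_ge0// integral_ge0.
- exact: measurableT_comp.
- by move: f0; apply: (@filterS _ _ aeF) => t h tT /=; rewrite ger0_norm// h.
Qed.

Lemma cmean_le f g : bmf f -> bmf g -> ae_circle (fun t => f t <= g t) ->
  cmean f <= cmean g.
Proof.
move=> hf hg fg; rewrite -subr_ge0 -cmeanB//; apply: cmean_ge0; first exact: bmfB.
by apply: ae_circleS fg => t; rewrite subr_ge0.
Qed.

Lemma cmean_dct (f_ : nat -> R -> R) f (M : R) : (forall n, bmf (f_ n)) ->
  measurable_fun T f -> ae_circle (fun t => forall n, `|f_ n t| <= M) ->
  ae_circle (fun t => f_ n t @[n --> \oo] --> f t) ->
  cmean (f_ n) @[n --> \oo] --> cmean f.
Proof.
move=> hf mf hM h; apply: cvgMr.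
have [] := @dominated_convergence _ _ _ mu T measurable_circle
  (fun n => EFin \o f_ n) (EFin \o f) (fun=> M%:E).
- by move=> n; apply/measurable_EFinP; case: (hf n).
- exact/measurable_EFinP.
- move: h; apply: (@filterS _ _ aeF) => t h tT.
  by apply: cvg_EFin; [exact: nearW|exact: h].
- exact: (bmf_integrable (bmf_cst M)).
- by move: hM; apply: (@filterS _ _ aeF) => t hn n tT; rewrite /= lee_fin hn.
move=> fi _ cf; apply: fine_cvg.
rewrite fineK; first exact: cf.
exact: integrable_fin_num.
Qed.

Lemma bmfC_cst (z : C) : bmfC (fun=> z).
Proof. by split; exact: bmf_cst. Qed.

Lemma bmfC_D F G : bmfC F -> bmfC G -> bmfC (fun t => F t + G t).
Proof.
move=> [? ?] [? ?]; split.
  by under eq_fun do rewrite Re_add; exact: bmfD.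
by under eq_fun do rewrite Im_add; exact: bmfD.
Qed.

Lemma bmfC_M F G : bmfC F -> bmfC G -> bmfC (fun t => F t * G t).
Proof.
move=> [? ?] [? ?]; split.
  by under eq_fun do rewrite Re_mul; apply: bmfB; exact: bmfM.
by under eq_fun do rewrite Im_mul; apply: bmfD; exact: bmfM.
Qed.

Lemma bmfC_conj F : bmfC F -> bmfC (fun t => conjc (F t)).
Proof.
move=> [? ?]; split; first by under eq_fun do rewrite Re_conjc.
by under eq_fun do rewrite Im_conjc; exact: bmfN.
Qed.

Lemma bmfC_X F k : bmfC F -> bmfC (fun t => F t ^+ k).
Proof.
move=> h; elim: k => [|k IH].
  by under eq_fun do rewrite expr0; exact: bmfC_cst.
by under eq_fun do rewrite exprS; exact: bmfC_M.
Qed.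

Lemma bmfC_sum (I : Type) (r : seq I) (F : I -> R -> C) :
  (forall i, bmfC (F i)) -> bmfC (fun t => \sum_(i <- r) F i t).
Proof.
move=> h; elim: r => [|i r IH].
  by under eq_fun do rewrite big_nil; exact: bmfC_cst.
by under eq_fun do rewrite big_cons; exact: bmfC_D.
Qed.

Lemma bmfC_nc2 F : bmfC F -> bmf (fun t => nc2 (F t)).
Proof.
move=> h; under eq_fun do rewrite nc2E.
by have [] := bmfC_M h (bmfC_conj h).
Qed.

Lemma bmfC_Re_mulJ F G : bmfC F -> bmfC G -> bmf (fun t => Re (F t * conjc (G t))).
Proof. by move=> hF hG; have [] := bmfC_M hF (bmfC_conj hG). Qed.

Lemma measurable_sqrt : measurable_fun setT (@Num.sqrt R).
Proof. by apply: continuous_measurable_fun => x; exact: sqrt_continuous. Qed.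

Lemma bmfC_nc F : bmfC F -> bmf (fun t => nc (F t)).
Proof.
move=> hF; have [mF [M hM]] := bmfC_nc2 hF; split.
  exact: (measurableT_comp measurable_sqrt mF).
exists (Num.sqrt M); apply: ae_circleS hM => t; rewrite ger0_norm ?nc2_ge0// => h.
by rewrite ger0_norm ?nc_ge0// ler_sqrt// (le_trans (nc2_ge0 _) h).
Qed.

Lemma bmfC_expi : bmfC (@expi R).
Proof.
split; split.
- apply: measurable_funTS; apply: continuous_measurable_fun; exact: continuous_cos.
- by exists 1; apply: ae_circleW => t; rewrite ler_norml cos_geN1 cos_le1.
- apply: measurable_funTS; apply: continuous_measurable_fun; exact: continuous_sin.
- by exists 1; apply: ae_circleW => t; rewrite ler_norml sin_geN1 sin_le1.
Qed.

Lemma bmfC_of_measurable F (M : R) : measurable_fun T (fun t => Re (F t)) ->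
  measurable_fun T (fun t => Im (F t)) -> ae_circle (fun t => nc (F t) <= M) -> bmfC F.
Proof.
move=> mr mi hM; split; split => //; exists M; apply: ae_circleS hM => t.
  exact: le_trans (Re_nc _).
exact: le_trans (Im_nc _).
Qed.

Lemma bmfC_lim (F_ : nat -> R -> C) F (M : R) : (forall n, bmfC (F_ n)) ->
  (forall t, cto (F_ ^~ t) (F t)) -> (forall t n, nc (F_ n t) <= M) -> bmfC F.
Proof.
move=> hF cF hM; apply: (@bmfC_of_measurable _ M).
- apply: (@measurable_fun_cvg _ _ _ _ (fun n t => Re (F_ n t))) => [n|t _].
    by have [[]] := hF n.
  by have /cto_ReIm[] := cF t.
- apply: (@measurable_fun_cvg _ _ _ _ (fun n t => Im (F_ n t))) => [n|t _].
    by have [_ []] := hF n.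
  by have /cto_ReIm[] := cF t.
- by apply: ae_circleW => t; apply: cto_nc_le (cF t) _ => n.
Qed.

Lemma expiX (t : R) m : expi t ^+ m = expi (m%:R * t).
Proof.
elim: m => [|m IH]; first by rewrite expr0 mul0r /expi cos0 sin0.
rewrite exprS IH -[m.+1]add1n natrD mulrDl mul1r /expi cosD sinD.
by apply/eqP; rewrite eq_complex/= eqxx/=; apply/eqP; ring.
Qed.

Lemma expiJX (t : R) j k : (k <= j)%N ->
  expi t ^+ j * conjc (expi t ^+ k) = expi t ^+ (j - k).
Proof.
move=> kj; rewrite -{1}(subnK kj) exprD -mulrA nc2_conjM -nc_sqr ncX nc_expi.
by rewrite !expr1n mulr1.
Qed.

Lemma cmean_expiX (w : C) m : (0 < m)%N -> cmean (fun t => Re (w * expi t ^+ m)) = 0.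
Proof.
move=> m0; case: w => a b.
(* An antiderivative of the integrand, with equal values at both ends of the period. *)
pose S (t : R) := m%:R^-1 * (a * sin (m%:R * t) + b * cos (m%:R * t)).
have m_neq0 : m%:R != 0 :> R by rewrite pnatr_eq0 -lt0n.
have dS (t : R) : is_derive t (1 : R) S (Re ((a +i* b) * expi t ^+ m)).
  rewrite expiX/=.
  have h1 : is_derive t (1 : R) (fun t : R => m%:R * t) (m%:R : R).
    by apply: is_derive_eq; rewrite /GRing.scale/= mulr1.
  have h2 := is_derive1_comp (is_derive_sin (m%:R * t)) h1.
  have h3 := is_derive1_comp (is_derive_cos (m%:R * t)) h1.
  have h4 := is_deriveZ m%:R^-1 (is_deriveD (is_deriveZ a h2) (is_deriveZ b h3)).
  apply: is_derive_eq h4 _; rewrite /GRing.scale/=.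
  by rewrite mulrDr !mulrA ![m%:R^-1 * _]mulrC -!mulrA; field.
rewrite /cmean /Rintegral (continuous_FTC2 (F := S) twopi_gt0).
- rewrite /S mulr0 sin0 cos0 (_ : m%:R * (2 * pi) = 0 + pi *+ 2 *+ m); last first.
    by rewrite add0r mulr_natl [2 * pi]mulr_natl.
  by rewrite (periodicn (@sinD2pi R)) (periodicn (@cosD2pi R)) sin0 cos0 -EFinB subrr/= mulr0.
- apply: continuous_subspaceT => t.
  have e : (fun t => Re ((a +i* b) * expi t ^+ m)) =
           (fun t => a * cos (m%:R * t) - b * sin (m%:R * t)).
    by apply/funext => x; rewrite expiX.
  rewrite e.
  have cm : {for t, continuous (fun t : R => m%:R * t)} by apply: cvgMr; exact: cvg_id.
  by apply: cvgB; apply: cvgMr; apply: continuous_comp cm _;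
    [exact: continuous_cos|exact: continuous_sin].
- split.
  + by move=> t _; have [] := dS t.
  + by apply: cvg_at_right_filter; apply: differentiable_continuous; apply/derivable1_diffP; have [] := dS 0.
  + by apply: cvg_at_left_filter; apply: differentiable_continuous; apply/derivable1_diffP; have [] := dS (2 * pi).
- by move=> t _; rewrite derive1E; have [_ ->] := dS t.
Qed.

Lemma cmean_expi_orth (w : C) j k :
  cmean (fun t => Re (w * (expi t ^+ j * conjc (expi t ^+ k)))) = if j == k then Re w else 0.
Proof.
case: ltngtP => [jk|kj|->].
- rewrite -[RHS](@cmean_expiX (conjc w) (k - j)) ?subn_gt0//; congr cmean.
  apply/funext => t; rewrite -expiJX ?(ltnW jk)// -[LHS]Re_conjc !rmorphM/= conjcK.
  by congr (Re (_ * _)); exact: mulrC.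
- rewrite -[RHS](@cmean_expiX w (j - k)) ?subn_gt0//; congr cmean.
  by apply/funext => t; rewrite expiJX// ltnW.
- rewrite -[RHS]cmean_cst; congr cmean; apply/funext => t.
  by rewrite expiJX// subnn expr0 mulr1.
Qed.

Lemma bmfC_psum c m : bmfC (fun t => psum c (expi t) m).
Proof.
apply: bmfC_sum => j; apply: bmfC_M (bmfC_cst _) _; exact/bmfC_X/bmfC_expi.
Qed.

(** The two lengths are independent so that [m] can tend to infinity against a fixed [k];
    frequencies from [k] on are orthogonal to the second factor. *)
Lemma cmean_parseval c d m k : (k <= m)%N ->
  cmean (fun t => Re (psum c (expi t) m * conjc (psum d (expi t) k))) =
  Re (\sum_(j < k) c j * conjc (d j)).
Proof.
move=> km.
have e : (fun t => Re (psum c (expi t) m * conjc (psum d (expi t) k))) =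
  (fun t => \sum_(l < k) \sum_(j < m)
     Re (c j * conjc (d l) * (expi t ^+ j * conjc (expi t ^+ l)))).
  apply/funext => t; rewrite /psum conjc_sum mulr_sumr Re_sum; apply: eq_bigr => l _.
  by rewrite mulr_suml Re_sum; apply: eq_bigr => j _; rewrite rmorphM/= mulrACA.
have hb j l : bmf (fun t => Re (c j * conjc (d l) * (expi t ^+ j * conjc (expi t ^+ l)))).
  suff [] : bmfC (fun t => c j * conjc (d l) * (expi t ^+ j * conjc (expi t ^+ l))) by [].
  apply: bmfC_M (bmfC_cst _) _; apply: bmfC_M; first exact/bmfC_X/bmfC_expi.
  exact/bmfC_conj/bmfC_X/bmfC_expi.
rewrite e cmean_sum; last by move=> l; apply: bmf_sum => j; exact: hb.
rewrite Re_sum; apply: eq_bigr => l _.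
rewrite cmean_sum; last by move=> j; exact: hb.
rewrite (bigD1 (widen_ord km l))//= cmean_expi_orth eqxx big1 ?addr0// => j jl.
rewrite cmean_expi_orth ifN//.
Qed.

(** On each half-line the inverse is, up to signs, the measurable power of exponent [-1]. *)
Lemma measurable_inv : measurable_fun setT (@GRing.inv R).
Proof.
have -> : @GRing.inv R = (fun x => if x < 0 then - ((- x) `^ (-1)) else x `^ (-1)).
  apply/funext => x; have [x0|x0] := ltP x 0; last by rewrite powR_inv1.
  by rewrite powR_inv1 ?oppr_ge0 ?(ltW x0)// invrN opprK.
apply: measurable_fun_if => //.
- by apply: measurable_fun_ltr => //; exact: measurable_cst.
- apply: measurable_funTS; apply: measurable_funN.
  apply: (measurableT_comp (f := @powR R ^~ (-1))); first exact: measurable_powR.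
  exact: oppr_measurable.
- by apply: measurable_funTS; exact: measurable_powR.
Qed.

End CircleMean.
#[global] Hint Resolve measurable_circle : core.

(** * Radial limits, energy bounds and a Fatou lemma for Hardy functions *)

Section Hardy.
Variable R : realType.
Local Notation C := R[i].
Local Notation mu := (@lebesgue_measure R).
Local Notation T := `[0, 2 * pi]%classic.
Implicit Types (c d : nat -> C) (u : C -> C) (r M S : R).

(** A fixed sequence of radii tending to 1, so that dominated convergence, which concerns sequences,
    applies to radial limits. *)
Definition rad (m : nat) : R := 1 - m.+2%:R^-1.

Lemma rad_lt1 m : rad m < 1.
Proof. by rewrite /rad ltrBlDr ltrDl invr_gt0. Qed.

Lemma rad_ge0 m : 0 <= rad m.
Proof. by rewrite /rad subr_ge0 invf_le1// ler1n. Qed.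

Lemma rad_circle m (t : R) : inD ((rad m)%:C * expi t).
Proof. exact: inD_circle (rad_ge0 m) (rad_lt1 m). Qed.

Lemma rad_cvg1 (e : R) : 0 < e -> exists N, forall m, (N <= m)%N -> 1 - e < rad m.
Proof.
move=> e0; have /cvgrPdist_lt/(_ _ e0)[N _ hN] := @cvg_harmonic R.
exists N => m Nm; have := hN m.+1 (leq_trans Nm (leqnSn _)).
by rewrite /harmonic/= sub0r normrN ger0_norm ?invr_ge0// /rad ltrD2l ltrN2.
Qed.

Lemma radial_lim_cto u t l : radial_lim u t l -> cto (fun m => u ((rad m)%:C * expi t)) l.
Proof.
move=> h e /h[d [d0 hd]]; have [N hN] := rad_cvg1 d0.
by exists N => m /hN rm; apply: hd => //; exact: rad_lt1.
Qed.

Lemma cto_radX j : cto (fun m => (rad m)%:C ^+ j) 1.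
Proof.
have h1 : cto (fun m => (rad m)%:C) 1.
  move=> e /rad_cvg1[N hN]; exists N => m /hN h.
  rewrite -(rmorph1 (real_complex R)) -rmorphB/= nc_real ltr0_norm ?subr_lt0 ?rad_lt1//.
  by rewrite opprB ltrBlDr addrC -ltrBlDr.
elim: j => [|j IH]; first by apply: cto_ext (cto_cst 1); exists 0%N => m _; rewrite expr0.
rewrite -[1]mulr1; apply: cto_ext (ctoM h1 IH); exists 0%N => m _.
by rewrite exprS.
Qed.

(** If [c] are the coefficients of [u], these are those of [z |-> u (r z)]. *)
Definition dil c r (j : nat) : C := c j * r%:C ^+ j.

Lemma psum_dil c r z m : psum (dil c r) z m = psum c (r%:C * z) m.
Proof. by apply: eq_bigr => j _; rewrite /dil exprMn mulrA. Qed.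

Lemma psum_circle_le c (t : R) m : nc (psum c (expi t) m) <= \sum_(j < m) nc (c j).
Proof.
apply: le_trans (nc_sum _ _ _) _; apply: ler_sum => j _.
by rewrite ncM ncX nc_expi expr1n mulr1.
Qed.

Lemma ps_circle_bound c u r : ps_rep c u -> 0 <= r -> r < 1 ->
  exists M, forall t m, nc (psum c (r%:C * expi t) m) <= M.
Proof.
move=> cu r0 r1; have [M [s [M0 s0 s1 h]]] := ps_geo cu r0 r1.
exists (M / (1 - s)) => t m; apply: psum_bound (ltW M0) s0 s1 _ h.
by rewrite nc_circle.
Qed.

Lemma bmfC_circle c u r : ps_rep c u -> 0 <= r -> r < 1 ->
  bmfC (fun t => u (r%:C * expi t)).
Proof.
move=> cu r0 r1; have [M hM] := ps_circle_bound cu r0 r1.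
apply: (@bmfC_lim _ (fun m t => psum c (r%:C * expi t) m)) hM => [m|t].
  by under eq_fun do rewrite -psum_dil; exact: bmfC_psum.
exact: ps_cto cu (inD_circle _ r0 r1).
Qed.

(** Replacing [u] by its partial sum of length [m], the mean is constant once [N <= m]; dominated
    convergence identifies its limit. *)
Lemma ps_pairing c u r d N : ps_rep c u -> 0 <= r -> r < 1 ->
  cmean (fun t => Re (u (r%:C * expi t) * conjc (psum d (expi t) N))) =
  Re (\sum_(j < N) dil c r j * conjc (d j)).
Proof.
move=> cu r0 r1; have [M hM] := ps_circle_bound cu r0 r1.
pose f m t := Re (psum c (r%:C * expi t) m * conjc (psum d (expi t) N)).
have bp m : bmfC (fun t => psum c (r%:C * expi t) m).
  by under eq_fun do rewrite -psum_dil; exact: bmfC_psum.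
have h : cmean (f m) @[m --> \oo] -->
    cmean (fun t => Re (u (r%:C * expi t) * conjc (psum d (expi t) N))).
  apply: (@cmean_dct _ f _ (M * \sum_(j < N) nc (d j))).
  - by move=> m; apply: bmfC_Re_mulJ => //; exact: bmfC_psum.
  - by have [] := bmfC_Re_mulJ (bmfC_circle cu r0 r1) (bmfC_psum d N).
  - apply: ae_circleW => t m; rewrite (le_trans (Re_nc _))// ncM nc_conj.
    by apply: ler_pM; rewrite ?nc_ge0 ?psum_circle_le.
  - apply: ae_circleW => t; apply: cto_Re; apply: ctoM (cto_cst _).
    exact: ps_cto cu (inD_circle _ r0 r1).
apply: (cvg_unique _ h) => //.
apply: cvg_near_cst; exists N => // m /= Nm.
rewrite -(cmean_parseval (dil c r) d Nm); congr cmean.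
by apply/funext => t; rewrite psum_dil.
Qed.

Lemma dil_nc2_le c r j : 0 <= r -> r < 1 -> nc2 (dil c r j) <= nc2 (c j).
Proof.
move=> r0 r1; rewrite nc2M -[X in _ * X]nc_sqr ncX nc_real ger0_norm// ler_piMr ?nc2_ge0//.
by rewrite exprn_ile1// ?exprn_ge0// exprn_ile1// ltW.
Qed.

Lemma ps_energy n (c : 'I_n -> nat -> C) (u : 'I_n -> C -> C) S r :
  (forall k, ps_rep (c k) (u k)) -> 0 <= r -> r < 1 ->
  (forall N, \sum_k \sum_(j < N) nc2 (c k j) <= S) ->
  cmean (fun t => \sum_k nc2 (u k (r%:C * expi t))) <= S.
Proof.
move=> cu r0 r1 hS.
have /choice[M hM] : forall k, exists M, forall t m, nc (psum (c k) (r%:C * expi t) m) <= M.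
  by move=> k; exact: ps_circle_bound (cu k) r0 r1.
pose f m t := \sum_k nc2 (psum (c k) (r%:C * expi t) m).
have bp k m : bmfC (fun t => psum (c k) (r%:C * expi t) m).
  by under eq_fun do rewrite -psum_dil; exact: bmfC_psum.
have h : cmean (f m) @[m --> \oo] --> cmean (fun t => \sum_k nc2 (u k (r%:C * expi t))).
  apply: (@cmean_dct _ f _ (\sum_k M k ^+ 2)).
  - by move=> m; apply: bmf_sum => k; exact: bmfC_nc2.
  - have [] : bmf (fun t => \sum_k nc2 (u k (r%:C * expi t))) => //.
    by apply: bmf_sum => k; apply: bmfC_nc2; exact: bmfC_circle (cu k) r0 r1.
  - apply: ae_circleW => t m; rewrite ger0_norm; last first.
      by apply: sumr_ge0 => k _; exact: nc2_ge0.
    apply: ler_sum => k _; rewrite -nc_sqr lerXn2r ?nnegrE ?nc_ge0//.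
    exact: le_trans (nc_ge0 _) (hM k t m).
  - apply: ae_circleW => t; apply: cvgr_sum => k; apply: cto_nc2.
    exact: ps_cto (cu k) (inD_circle _ r0 r1).
rewrite -(cvg_lim _ h)//; apply: limr_le; first by apply/cvg_ex; eexists; exact: h.
apply: nearW => m; rewrite cmean_sum; last by move=> k; exact: bmfC_nc2.
apply: le_trans (hS m); apply: ler_sum => k _.
under eq_fun do rewrite -psum_dil nc2E.
rewrite cmean_parseval// Re_sum; apply: ler_sum => j _.
by rewrite -nc2E dil_nc2_le.
Qed.

(** A lower limit, because it will be applied to [B A^-1], whose radial limits are not given. *)
Definition radial_liminf_ge n (u : 'I_n -> C -> C) (t x : R) :=
  forall e : R, 0 < e -> exists N, forall m, (N <= m)%N ->
    x - e <= \sum_k nc2 (u k ((rad m)%:C * expi t)).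

(** The radial energies cut at the bounded [G] are dominated, and the lower limit makes them
    converge to [G]; each cut has mean at most [S]. *)
Lemma hardy_fatou n (c : 'I_n -> nat -> C) (u : 'I_n -> C -> C) S (G : R -> R) :
  (forall k, ps_rep (c k) (u k)) ->
  (forall N, \sum_k \sum_(j < N) nc2 (c k j) <= S) ->
  bmf G -> ae_circle (fun t => radial_liminf_ge u t (G t)) -> cmean G <= S.
Proof.
move=> cu hS bG hG.
pose F m t := \sum_k nc2 (u k ((rad m)%:C * expi t)).
have F0 m t : 0 <= F m t by apply: sumr_ge0 => k _; exact: nc2_ge0.
have bF m : bmf (F m).
  apply: bmf_sum => k; apply: bmfC_nc2.
  exact: bmfC_circle (cu k) (rad_ge0 m) (rad_lt1 m).
have [mG [M hM]] := bG.
have h : cmean (fun t => Num.min (F m t) (G t)) @[m --> \oo] --> cmean G.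
  apply: (@cmean_dct _ _ _ M) => //.
  - by move=> m; exact: bmf_min.
  - apply: ae_circleS hM => t hM m; apply: le_trans hM.
    have [h|h] := leP (F m t) (G t); last by [].
    by rewrite !ger0_norm// (le_trans (F0 m t)).
  - apply: ae_circleS hG => t hG; apply/cvgrPdist_le => e e0.
    have [N hN] := hG e e0; exists N => // m /= /hN h.
    rewrite ger0_norm ?subr_ge0 ?ge_min ?lexx ?orbT//.
    by have [_|_] := leP (F m t) (G t); [rewrite lerBlDr addrC -lerBlDr|rewrite subrr ltW].
rewrite -(cvg_lim _ h)//; apply: limr_le; first by apply/cvg_ex; eexists; exact: h.
apply: nearW => m; apply: (@le_trans _ _ (cmean (F m))).
  apply: cmean_le => //; first exact: bmf_min.
  by apply: ae_circleW => t; rewrite ge_min lexx.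
exact: ps_energy cu (rad_ge0 m) (rad_lt1 m) hS.
Qed.

(** The bounded case applies to the cuts of [G] at height [m], and monotone convergence bounds the
    whole integral by [2 pi S]. *)
Lemma hardy_fatou_integrable n (c : 'I_n -> nat -> C) (u : 'I_n -> C -> C) S (G : R -> R) :
  (forall k, ps_rep (c k) (u k)) ->
  (forall N, \sum_k \sum_(j < N) nc2 (c k j) <= S) ->
  measurable_fun T G -> ae_circle (fun t => 0 <= G t) ->
  ae_circle (fun t => radial_liminf_ge u t (G t)) -> mu.-integrable T (EFin \o G).
Proof.
move=> cu hS mG G0 hG; apply/integrableP; split; first exact/measurable_EFinP.
pose g (m : nat) t := Num.min `|G t| m%:R.
have mg m : measurable_fun T (g m).
  by apply: measurable_minr; [exact: measurableT_comp|exact: measurable_cst].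
have g0 m t : 0 <= g m t by rewrite le_min normr_ge0/=.
have bg m : bmf (g m).
  split => //; exists m%:R; apply: ae_circleW => t.
  by rewrite ger0_norm// ge_min lexx orbT.
have cg m : cmean (g m) <= S.
  apply: hardy_fatou cu hS (bg m) _.
  apply: ae_circleS (ae_circleI G0 hG) => t [Gt h] e /h[N hN].
  exists N => m' /hN; apply: le_trans; rewrite lerB// /g (ger0_norm Gt).
  by rewrite ge_min lexx.
have cvg_g t : g m t @[m --> \oo] --> `|G t|.
  apply: cvg_near_cst; exists (Num.bound `|G t|) => // m /= hm.
  apply/min_idPl; apply: le_trans (ltW (archi_boundP (normr_ge0 _))) _.
  by rewrite ler_nat.
have := @cvg_monotone_convergence _ _ _ mu T (@measurable_circle R) (fun m => EFin \o g m).
have h1 m : measurable_fun T (EFin \o g m) by exact/measurable_EFinP.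
have h2 (m : nat) (t : R) : T t -> (0 <= (EFin \o g m) t)%E by move=> _; rewrite lee_fin.
have h3 (t : R) : T t -> {homo (fun m => (EFin \o g m) t) : m m' / (m <= m')%N >-> (m <= m')%E}.
  move=> _ m m' mm'; rewrite lee_fin /g le_min ge_min lexx/=.
  by rewrite ge_min ler_nat mm' orbT.
move=> /(_ h1 h2 h3) h.
rewrite (_ : (\int[mu]_(t in T) _)%E = (\int[mu]_(t in T) limn (fun m => (EFin \o g m) t))%E).
  rewrite -(cvg_lim _ h)//; apply: (@le_lt_trans _ _ (2 * pi * S)%:E); last exact: ltry.
  apply: lime_le; first by apply/cvg_ex; eexists; exact: h.
  apply: nearW => m; rewrite -[leLHS]fineK; last first.
    by apply: integrable_fin_num => //; exact: bmf_integrable.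
  by rewrite lee_fin -ler_pdivrMl ?twopi_gt0//; exact: cg.
apply: eq_integral => t _; apply/esym/cvg_lim => //=.
by apply: cvg_EFin; [exact: nearW|exact: cvg_g].
Qed.

(** The nonnegative Fourier coefficients of the boundary function are the Taylor coefficients: on
    the circles of radius [rad m] they are the dilated ones, and bounded convergence carries both
    sides to radius 1. *)
Lemma hardy_boundary c u M (ub : R -> C) d N :
  ps_rep c u -> (forall z, inD z -> nc (u z) <= M) -> bmfC ub ->
  ae_circle (fun t => cto (fun m => u ((rad m)%:C * expi t)) (ub t)) ->
  cmean (fun t => Re (ub t * conjc (psum d (expi t) N))) =
  Re (\sum_(j < N) c j * conjc (d j)).
Proof.
move=> cu uM bu hu.
have h : cmean (fun t => Re (u ((rad m)%:C * expi t) * conjc (psum d (expi t) N)))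
    @[m --> \oo] --> cmean (fun t => Re (ub t * conjc (psum d (expi t) N))).
  apply: (@cmean_dct _ _ _ (M * \sum_(j < N) nc (d j))).
  - move=> m; apply: bmfC_Re_mulJ (bmfC_psum _ _).
    exact: bmfC_circle cu (rad_ge0 m) (rad_lt1 m).
  - by have [] := bmfC_Re_mulJ bu (bmfC_psum d N).
  - apply: ae_circleW => t m; rewrite (le_trans (Re_nc _))// ncM nc_conj.
    by apply: ler_pM; rewrite ?nc_ge0 ?psum_circle_le ?uM//; exact: rad_circle.
  - by apply: ae_circleS hu => t hu; apply: cto_Re; apply: ctoM (cto_cst _).
apply: (cvg_unique _ h) => //.
rewrite (_ : (fun m => _) = (fun m => Re (\sum_(j < N) dil c (rad m) j * conjc (d j)))); last first.
  by apply/funext => m; exact: ps_pairing d N cu (rad_ge0 m) (rad_lt1 m).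
apply: cto_Re; apply: cto_sum => j _.
rewrite -[X in cto _ (X * _)]mulr1; apply: ctoM (cto_cst _); exact: ctoZ (cto_radX j).
Qed.

Definition monc (w : C) (m j : nat) : C := if j == m then w else 0.

Lemma psum_monc w m z N : (m < N)%N -> psum (monc w m) z N = w * z ^+ m.
Proof.
move=> mN; rewrite /psum (bigD1 (Ordinal mN))//= /monc eqxx big1 ?addr0// => j jm.
by rewrite ifN ?mul0r//; apply: contra jm => /eqP jm; apply/eqP/val_inj.
Qed.

Lemma ps_monc w m : ps_rep (monc w m) (fun z => w * z ^+ m).
Proof.
by move=> z _; apply: cto_ext (cto_cst _); exists m.+1 => N mN; rewrite -(psum_monc w z mN).
Qed.

Lemma sum_monc c w m N : (m < N)%N -> \sum_(j < N) c j * conjc (monc w m j) = c m * conjc w.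
Proof.
move=> mN; rewrite (bigD1 (Ordinal mN))//= /monc eqxx big1 ?addr0// => j jm.
by rewrite ifN ?rmorph0 ?mulr0//; apply: contra jm => /eqP jm; apply/eqP/val_inj.
Qed.

Lemma hardy_coef_le c u M (ub : R -> C) m :
  ps_rep c u -> (forall z, inD z -> nc (u z) <= M) -> bmfC ub ->
  ae_circle (fun t => cto (fun m => u ((rad m)%:C * expi t)) (ub t)) ->
  nc (c m) <= cmean (fun t => nc (ub t)).
Proof.
move=> cu uM bu hu.
have [c0|c0] := eqVneq (c m) 0.
  rewrite c0 nc0; apply: cmean_ge0; first exact: bmfC_nc.
  by apply: ae_circleW => t; exact: nc_ge0.
have nc0 : nc (c m) != 0 by rewrite nc_eq0.
(* The phase of [c m]: pairing with the unimodular [w z^m] returns [|c m|]. *)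
pose w := (nc (c m))^-1%:C * c m.
have nw : nc w = 1 by rewrite ncM nc_real ger0_norm ?invr_ge0 ?nc_ge0// mulVf.
have <- : Re (c m * conjc w) = nc (c m).
  rewrite Re_mulJC -mulrA Re_realM -nc2E -nc_sqr expr2 mulrA mulVf// mul1r//.
rewrite -(sum_monc c w (ltnSn m)) -(hardy_boundary _ _ cu uM bu hu).
apply: cmean_le; first by apply: bmfC_Re_mulJ => //; exact: bmfC_psum.
  exact: bmfC_nc.
apply: ae_circleW => t; rewrite psum_monc//; apply: le_trans (Re_le_nc _) _.
by rewrite ncM nc_conj ncM ncX nc_expi expr1n nw !mulr1.
Qed.

Lemma ps_unique c d u : ps_rep c u -> ps_rep d u -> c =1 d.
Proof.
move=> cu du m; apply/eqP; rewrite -subr_eq0.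
have r0 : (0 : R) <= 2^-1 by [].
have r1 : (2^-1 : R) < 1 by rewrite invf_lt1// ltr1n.
(* At radius 1/2 the difference of the two pairings with [w z^m] is [|w|^2]. *)
pose z : C := (2^-1 : R)%:C ^+ m; pose w := (c m - d m) * z.
have z0 : z != 0 by rewrite expf_neq0// -(rmorph0 (real_complex R)) (inj_eq (@complexI R)).
have := ps_pairing (monc w m) m.+1 cu r0 r1.
rewrite (ps_pairing (monc w m) m.+1 du r0 r1) !sum_monc// => /eqP.
rewrite eq_sym -subr_eq0 -Re_sub -mulrBl /dil -mulrBl -/w -nc2E -nc_sqr sqrf_eq0 nc_eq0.
by rewrite mulf_eq0 (negbTE z0) orbF.
Qed.

(** Bessel's inequality on each circle: [|u - p|^2] has nonnegative mean for [p] the dilated partial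
    sum. The radius then tends to 1. *)
Lemma hardy_bessel c u M : ps_rep c u -> (forall z, inD z -> nc (u z) <= M) ->
  forall N, \sum_(j < N) nc2 (c j) <= M ^+ 2.
Proof.
move=> cu uM N.
have M0 : 0 <= M by apply: le_trans (nc_ge0 _) (uM 0 _); rewrite /inD nc0 ltr01.
have h m : \sum_(j < N) nc2 (dil c (rad m) j) <= M ^+ 2.
  set X := leLHS; set d := dil c (rad m).
  have bu := bmfC_circle cu (rad_ge0 m) (rad_lt1 m).
  have bp := bmfC_psum d N.
  have h1 := ps_pairing d N cu (rad_ge0 m) (rad_lt1 m).
  have h2 := cmean_parseval d d (leqnn N).
  have eX : Re (\sum_(j < N) d j * conjc (d j)) = X.
    by rewrite Re_sum; apply: eq_bigr => j _; rewrite -nc2E.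
  have bn := bmfC_nc2 bu.
  have : cmean (fun t => nc2 (u ((rad m)%:C * expi t))) <= M ^+ 2.
    rewrite -[leRHS]cmean_cst; apply: cmean_le => //; first exact: bmf_cst.
    apply: ae_circleW => t; rewrite -nc_sqr lerXn2r ?nnegrE ?nc_ge0// uM//.
    exact: rad_circle.
  have : 0 <= cmean (fun t => nc2 (u ((rad m)%:C * expi t) - psum d (expi t) N)).
    apply: cmean_ge0; last by apply: ae_circleW => t; exact: nc2_ge0.
    apply: bmfC_nc2; apply: bmfC_D => //.
    by under eq_fun do rewrite -mulN1r; exact: bmfC_M (bmfC_cst _) _.
  under eq_fun do rewrite nc2B [nc2 (psum _ _ _)]nc2E.
  have b1 := bmfC_Re_mulJ bu bp; have b2 := bmfC_Re_mulJ bp bp.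
  have b3 := bmfM (bmf_cst 2) b1.
  rewrite cmeanD//; last exact: bmfB.
  rewrite cmeanB// cmeanZ// h1 h2 eX; lra.
have hc : \sum_(j < N) nc2 (dil c (rad m) j) @[m --> \oo] --> \sum_(j < N) nc2 (c j).
  apply: cvgr_sum => j; apply: cto_nc2; rewrite -[X in cto _ X]mulr1.
  exact: ctoZ (cto_radX j).
rewrite -(cvg_lim _ hc)//; apply: limr_le; first by apply/cvg_ex; eexists; exact: hc.
exact: nearW.
Qed.

End Hardy.

(** * Division by an outer matrix function *)

Section OuterFactor.
Variable R : realType.
Local Notation C := R[i].
Implicit Types (c d a : nat -> C) (e S : R).

Lemma conv_coef (p q : {poly C}) c d m :
  (forall j, (j <= m)%N -> p`_j = c j) -> (forall j, (j <= m)%N -> q`_j = d j) ->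
  conv c d m = (p * q)`_m.
Proof.
move=> hp hq; rewrite coefM; apply: eq_bigr => j _.
by rewrite hp ?hq ?leq_subr//; have := ltn_ord j; rewrite ltnS.
Qed.

(** Coefficient [m] sees only indices up to [m], so associativity is inherited from truncated
    polynomials. *)
Lemma convA a c d : conv (conv a c) d =1 conv a (conv c d).
Proof.
move=> m; pose P x : {poly C} := \poly_(i < m.+1) (x i : C).
have hP x j : (j <= m)%N -> (P x)`_j = x j by rewrite coef_poly ltnS => ->.
have hM x y j : (j <= m)%N -> (P x * P y)`_j = conv x y j.
  by move=> jm; rewrite -(conv_coef (c := x) (d := y))// => i ij; apply: hP; exact: leq_trans jm.
rewrite (conv_coef (hM a c) (hP d)) (conv_coef (hP a) (hM c d)).
by rewrite mulrA.
Qed.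

Lemma conv_suml n (c : 'I_n -> nat -> C) d m :
  conv (fun j => \sum_k c k j) d m = \sum_k conv (c k) d m.
Proof. by rewrite exchange_big; apply: eq_bigr => j _; rewrite mulr_suml. Qed.

Lemma conv_sumr n c (d : 'I_n -> nat -> C) m :
  conv c (fun j => \sum_k d k j) m = \sum_k conv c (d k) m.
Proof. by rewrite exchange_big; apply: eq_bigr => j _; rewrite mulr_sumr. Qed.

Lemma ps_at0 c f : ps_rep c f -> f 0 = c 0%N.
Proof.
move=> cf; have /(ps_cto cf) h : inD (0 : C) by rewrite /inD nc0.
apply: (cto_unique h); apply: cto_ext (cto_cst _); exists 1%N => -[//|m] _.
by rewrite /psum big_ord_recl expr0 mulr1 big1 ?addr0// => j _; rewrite expr0n mulr0.
Qed.

(** Boundedness of point evaluation on [H^2]: Cauchy-Schwarz against the sequence [z^j]. *)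
Lemma ps_eval_le c f e z : ps_rep c f -> inD z ->
  (forall N, \sum_(j < N) nc2 (c j) <= e) -> nc2 (f z) <= e / (1 - nc2 z).
Proof.
move=> cf zD he; have h := cto_nc2 (ps_cto cf zD).
have z1 : nc2 z < 1 by rewrite -nc_sqr expr_lt1// nc_ge0.
rewrite -(cvg_lim _ h)//; apply: limr_le; first by apply/cvg_ex; eexists; exact: h.
apply: nearW => m; apply: le_trans (nc2_sumM_le _ _) _.
apply: ler_pM; rewrite ?he//; try by apply: sumr_ge0 => j _; exact: nc2_ge0.
apply: le_trans (geo_sum m (nc2_ge0 z) z1); apply: ler_sum => j _.
by rewrite -nc_sqr ncX -nc_sqr -!exprM mulnC.
Qed.

Variable n : nat.
Implicit Types (w : 'I_n -> {poly C}).

(** Coefficient [m] of [B w] for a row [B] with coefficients [b]; with [al k] for [b] it is that of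
    entry [k] of [A w]. *)
Definition row_app (b : 'I_n -> nat -> C) w (m : nat) : C :=
  \sum_l conv (b l) (fun j => (w l)`_j) m.

Lemma ps_row_app (b : 'I_n -> nat -> C) (B : 'I_n -> C -> C) w :
  (forall l, ps_rep (b l) (B l)) ->
  ps_rep (row_app b w) (fun z => \sum_l B l z * (w l).[z]).
Proof.
by move=> hb; apply: ps_sum => l _; apply: ps_mul (hb l) _; exact: ps_poly.
Qed.

Variables (A : C -> 'M[C]_n) (al : 'I_n -> 'I_n -> nat -> C).
Hypothesis outA : outer_mx A.
Hypothesis Aal : forall i j, ps_rep (al i j) (fun z => A z i j).

Lemma outer_approx (g : 'I_n -> nat -> C) e : (forall k, sqsum (g k)) -> 0 < e ->
  exists w, forall N, \sum_k \sum_(j < N) nc2 (row_app (al k) w j - g k j) <= e.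
Proof.
move=> hg e0; have [p [c [hc h]]] := outA.2 g hg e e0; exists p => N.
apply: le_trans (h N); rewrite le_eqVlt; apply/orP; left; apply/eqP.
apply: eq_bigr => k _; apply: eq_bigr => j _; congr (nc2 (_ - _)).
apply: (@ps_unique R _ _ (fun z => (A z *m \col_l (p l).[z]) k 0)); last exact: hc.
apply: ps_ext (ps_row_app p (Aal k)) => z _; rewrite mxE.
by apply: eq_bigr => l _; rewrite mxE.
Qed.

Lemma sqsum_finite c N : (forall j, (N <= j)%N -> c j = 0) -> sqsum c.
Proof.
move=> h; exists (\sum_(j < N) nc2 (c j)) => M.
have [MN|NM] := leqP M N.
  rewrite (big_ord_widen _ (fun j => nc2 (c j)) MN) [leRHS](bigID (fun j : 'I_N => (j < M)%N))/=.
  by rewrite lerDl; apply: sumr_ge0 => j _; exact: nc2_ge0.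
rewrite (big_ord_widen _ (fun j => nc2 (c j)) (ltnW NM)).
rewrite (bigID (fun j : 'I_M => (j < N)%N))/= [X in _ + X]big1 ?addr0// => j.
by rewrite -leqNgt => /h->; rewrite nc20.
Qed.

(** A row [v] killing [A z] kills [(A w)(z)] for every [w]. But some [A w] is close to the constant
    column [conj v], and evaluation at [z] is bounded, so [v] would be nearly orthogonal to
    itself. *)
Lemma outer_unitmx z : inD z -> A z \in unitmx.
Proof.
move=> zD; rewrite unitmxE unitfE; apply/negP => /det0P[v v0 vA].
have z1 : 0 < 1 - nc2 z by rewrite subr_gt0 -nc_sqr expr_lt1// nc_ge0.
pose V := \sum_k nc2 (v 0 k).
have V0 : 0 < V.
  rewrite lt_neqAle sumr_ge0 ?andbT; last by move=> k _; exact: nc2_ge0.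
  apply: contra v0; rewrite eq_sym psumr_eq0; last by move=> k _; exact: nc2_ge0.
  move=> /allP h; apply/eqP/rowP => k; rewrite mxE; apply/eqP.
  by have := h k (mem_index_enum _); rewrite /= -nc_sqr sqrf_eq0 nc_eq0.
pose g k := monc (conjc (v 0 k)) 0.
(* Evaluation costs [1 / (1 - |z|^2)] in each of [n] coordinates; dividing by [n + 1] keeps the
   total strictly below [V]. *)
pose e := V * (1 - nc2 z) / n.+1%:R.
have e0 : 0 < e by rewrite divr_gt0// mulr_gt0.
have [|w hw] := @outer_approx g e _ e0.
  by move=> k; apply: (@sqsum_finite _ 1) => -[].
pose F k z := \sum_l A z k l * (w l).[z].
have hF k : ps_rep (fun j => row_app (al k) w j - g k j) (fun z => F k z - conjc (v 0 k)).
  apply: ps_sub; first exact: ps_row_app (Aal k).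
  by apply: ps_ext (ps_monc _ _) => x _; rewrite expr0 mulr1.
have sF : \sum_k v 0 k * F k z = 0.
  under eq_bigr do rewrite mulr_sumr.
  rewrite exchange_big big1//= => l _; under eq_bigr do rewrite mulrA.
  rewrite -mulr_suml; have /rowP/(_ l) := vA; rewrite !mxE => ->.
  by rewrite mul0r.
have eV : \sum_k v 0 k * (F k z - conjc (v 0 k)) = - V%:C.
  under eq_bigr do rewrite mulrBr nc2_conjM.
  by rewrite sumrB sF sub0r rmorph_sum.
have := nc2_sumM_le (fun k => v 0 k) (fun k => F k z - conjc (v 0 k)).
rewrite eV nc2N nc2_real expr2 -/V ler_pM2l//; apply/negP; rewrite -ltNge.
apply: (@le_lt_trans _ _ (\sum_(k < n) e / (1 - nc2 z))).
  apply: ler_sum => k _; apply: ps_eval_le (hF k) zD _ => N.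
  apply: le_trans (hw N); rewrite (bigD1 k)//= lerDl.
  by apply: sumr_ge0 => i _; apply: sumr_ge0 => j _; exact: nc2_ge0.
rewrite sumr_const card_ord -mulr_natl /e.
have simpl_frac (q k x : R) : q != 0 -> k != 0 -> x * (V * q / k / q) = V * (x / k).
  by move=> q0 k0; field; rewrite q0 k0.
rewrite simpl_frac ?pnatr_eq0// ?gt_eqF//.
by rewrite gtr_pMr// ltr_pdivrMr// mul1r ltr_nat.
Qed.

(** * The formal power series [c] with [c A = B], and its energy *)

Section FormalQuotient.
Variables (b : 'I_n -> nat -> C).

Let Am (m : nat) : 'M[C]_n := \matrix_(i, j) al i j m.
Let Bm (m : nat) : 'rV[C]_n := \row_k b k m.

Let Am0 : Am 0 \in unitmx.
Proof.
have -> : Am 0 = A 0 by apply/matrixP => i j; rewrite mxE -(ps_at0 (Aal i j)).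
by apply: outer_unitmx; rewrite /inD nc0.
Qed.

(** Strong recursion by tabulation: stage [N] holds the coefficients of index below [N], and 0
    beyond. Each new one is solved for by inverting the constant coefficient of [A]. *)
Fixpoint quot_upto (N : nat) : nat -> 'rV[C]_n :=
  if N is N'.+1 then fun j =>
    if j == N' then
      (Bm N' - \sum_(i < N') quot_upto N' i *m Am (N' - i)) *m invmx (Am 0)
    else quot_upto N' j
  else fun=> 0.

Definition quot (j : nat) : 'rV[C]_n := quot_upto j.+1 j.

Lemma quot_uptoE N j : (j < N)%N -> quot_upto N j = quot j.
Proof.
elim: N => // N IH; rewrite ltnS leq_eqVlt => /orP[/eqP->//|jN].
by rewrite /= ltn_eqF// IH.
Qed.

Lemma quot_mul m : \sum_(j < m.+1) quot j *m Am (m - j) = Bm m.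
Proof.
rewrite big_ord_recr/= subnn {2}/quot/= eqxx mulmxKV// addrC.
rewrite (eq_bigr (fun i : 'I_m => quot i *m Am (m - i))); first by rewrite subrK.
by move=> i _; rewrite quot_uptoE.
Qed.

Lemma quot_conv l : (fun m => \sum_k conv (fun j => quot j 0 k) (al k l) m) =1 b l.
Proof.
move=> m; have /rowP/(_ l) := quot_mul m; rewrite [RHS]mxE => <-.
rewrite summxE exchange_big; apply: eq_bigr => j _; rewrite mxE.
by apply: eq_bigr => k _; rewrite mxE.
Qed.

(** [B w = c (A w)] by associativity, coefficient by coefficient, while convergence of [c] is still
    open. *)
Lemma row_app_quot w m :
  row_app b w m = \sum_k conv (fun j => quot j 0 k) (row_app (al k) w) m.
Proof.
rewrite [RHS](eq_bigr _ (fun k _ => conv_sumr _ _ m)) exchange_big/=.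
apply: eq_bigr => l _; rewrite -(funext (quot_conv l)) conv_suml.
by apply: eq_bigr => k _; rewrite convA.
Qed.

Lemma nc2D_le (x y : C) e : 0 < e ->
  nc2 (x + y) <= (1 + e) * nc2 x + (1 + e^-1) * nc2 y.
Proof.
move=> e0; rewrite nc2D.
have h : 2 * Re (x * conjc y) <= e * nc2 x + e^-1 * nc2 y.
  have := nc2_ge0 (e%:C * x - y); rewrite nc2B nc2M nc2_real -mulrA Re_realM => h.
  rewrite -(ler_pM2l e0) mulrDr [e * (e^-1 * _)]mulrA mulfV ?gt_eqF// mul1r; lra.
lra.
Qed.

(** Coefficient [m] of a product pairs one factor with the reversal of the other. So for [g] the
    reflection of [c] at [m], coefficient [m] of [c g] is [X] while [g] has energy at most [X];
    taking [A w] near [g], the hypothesis becomes [X^2 <= S X] up to an error. *)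
Lemma quot_energy S : 0 <= S ->
  (forall w m E, (forall N, \sum_k \sum_(j < N) nc2 (row_app (al k) w j) <= E) ->
     nc2 (row_app b w m) <= S * E) ->
  forall N, \sum_k \sum_(j < N) nc2 (quot j 0 k) <= S.
Proof.
move=> S0 H [|m]; first by rewrite big1// => k _; rewrite big_ord0.
set X := leLHS.
have X0 : 0 <= X by apply: sumr_ge0 => k _; apply: sumr_ge0 => j _; exact: nc2_ge0.
pose g k j := if (j <= m)%N then conjc (quot (m - j) 0 k) else 0.
have gX N : \sum_k \sum_(j < N) nc2 (g k j) <= X.
  apply: ler_sum => k _.
  rewrite [leRHS](_ : _ = \sum_(j < m.+1) nc2 (g k j)); last first.
    rewrite [RHS](reindex_inj rev_ord_inj)/=; apply: eq_bigr => j _.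
    have jm : (j <= m)%N by have := ltn_ord j; rewrite ltnS.
    by rewrite /g subSS leq_subr subKn// nc2_conj.
  have [Nm|mN] := leqP N m.+1.
    rewrite (big_ord_widen _ (fun j => nc2 (g k j)) Nm) [leRHS](bigID (fun j : 'I_m.+1 => (j < N)%N))/=.
    by rewrite lerDl; apply: sumr_ge0 => j _; exact: nc2_ge0.
  rewrite (big_ord_widen _ (fun j => nc2 (g k j)) (ltnW mN)).
  rewrite (bigID (fun j : 'I_N => (j < m.+1)%N))/= [X in _ + X]big1 ?addr0// => j.
  by rewrite /g ltnS => /negbTE->; rewrite nc20.
have key e : 0 < e -> e < 1 -> X ^+ 2 <= S * X + e * (3 * S * X + 4 * S + 2 * X).
  move=> e0 e1; have e20 : 0 < e ^+ 2 by rewrite exprn_gt0.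
  (* Accuracy [e ^+ 2], because [nc2D_le] multiplies this error by [1 + e^-1]; what remains is of
     order [e]. *)
  have [|w hw] := @outer_approx g (e ^+ 2) _ e20.
    by move=> k; apply: (@sqsum_finite _ m.+1) => j mj; rewrite /g leqNgt mj.
  have ei : e^-1 * e ^+ 2 = e by rewrite expr2 mulrA mulVf ?gt_eqF// mul1r.
  have hE N : \sum_k \sum_(j < N) nc2 (row_app (al k) w j) <= (1 + e) * X + (e ^+ 2 + e).
    apply: (@le_trans _ _ ((1 + e) * (\sum_k \sum_(j < N) nc2 (g k j)) +
       (1 + e^-1) * (\sum_k \sum_(j < N) nc2 (row_app (al k) w j - g k j)))).
      rewrite !mulr_sumr -big_split/=; apply: ler_sum => k _.
      rewrite !mulr_sumr -big_split/=; apply: ler_sum => j _.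
      by have := nc2D_le (g k j) (row_app (al k) w j - g k j) e0; rewrite [g k j + _]addrC subrK.
    apply: lerD; first by rewrite ler_wpM2l// addr_ge0// ltW.
    apply: (@le_trans _ _ ((1 + e^-1) * e ^+ 2)); last by rewrite mulrDl mul1r ei.
    by rewrite ler_wpM2l// addr_ge0// invr_ge0 ltW.
  have := H w m _ hE; rewrite row_app_quot; set z := (X in nc2 X) => hz.
  pose q (p : 'I_n * 'I_m.+1) : C := quot p.2 0 p.1.
  pose y (p : 'I_n * 'I_m.+1) : C := row_app (al p.1) w (m - p.2) - g p.1 (m - p.2)%N.
  have qX : \sum_p nc2 (q p) = X by rewrite /X pair_bigA.
  have ye : \sum_p nc2 (y p) <= e ^+ 2.
    apply: le_trans (hw m.+1).
    rewrite -(pair_bigA _ (fun k (j : 'I_m.+1) => nc2 (row_app (al k) w (m - j) - g k (m - j)%N))).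
    apply: ler_sum => k _; rewrite [leRHS](reindex_inj rev_ord_inj)/=.
    by apply: ler_sum => j _; rewrite subSS.
  have zE : X%:C = z + - \sum_p q p * y p.
    rewrite /z -(pair_bigA _ (fun k (j : 'I_m.+1) => quot j 0 k * (row_app (al k) w (m - j) - g k (m - j)%N))).
    rewrite -sumrB rmorph_sum; apply: eq_bigr => k _.
    rewrite -sumrB rmorph_sum; apply: eq_bigr => j _.
    have jm : (j <= m)%N by have := ltn_ord j; rewrite ltnS.
    by rewrite -mulrBr opprB addrC subrK /g leq_subr subKn// nc2_conjM.
  have h1 := nc2_sumM_le q y.
  have h2 : nc2 (\sum_p q p * y p) <= X * e ^+ 2.
    by apply: le_trans h1 _; rewrite qX ler_wpM2l.
  have := nc2D_le z (- \sum_p q p * y p) e0; rewrite -zE nc2_real nc2N => h3.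
  apply: le_trans h3 _.
  apply: (@le_trans _ _ ((1 + e) * (S * ((1 + e) * X + (e ^+ 2 + e))) + (1 + e^-1) * (X * e ^+ 2))).
    apply: lerD; first by rewrite ler_wpM2l// addr_ge0// ltW.
    by rewrite ler_wpM2l// addr_ge0// invr_ge0 ltW.
  rewrite [(1 + e^-1) * _](_ : _ = X * (e ^+ 2 + e)); last first.
    by rewrite mulrCA mulrDl mul1r ei.
  have e2 : e ^+ 2 <= e by rewrite expr2 ger_pMl// ltW.
  have SX : 0 <= S * X by rewrite mulr_ge0.
  have -> : (1 + e) * (S * ((1 + e) * X + (e ^+ 2 + e))) =
    S * X * (1 + 2 * e + e ^+ 2) + S * (e + 2 * e ^+ 2 + e ^+ 2 * e) by ring.
  have e3 : e ^+ 2 * e <= e by rewrite -[leRHS]mul1r ler_wpM2r ?(ltW e0)// expr_le1// ltW.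
  apply: (@le_trans _ _ (S * X * (1 + 3 * e) + S * (4 * e) + X * (2 * e))); last by lra.
  apply: lerD; last by rewrite ler_wpM2l//; lra.
  by apply: lerD; rewrite ler_wpM2l//; lra.
have hX : X ^+ 2 <= S * X.
  apply/ler_addgt0Pl => d d0.
  set K := 3 * S * X + 4 * S + 2 * X in key.
  have K0 : 0 <= K by rewrite /K !addr_ge0 ?mulr_ge0.
  (* Chosen so that [e < 1] and [e * K <= d]. *)
  pose e := d / (d + K + 1).
  have e0 : 0 < e by rewrite divr_gt0//; lra.
  have e1 : e < 1 by rewrite ltr_pdivrMr; lra.
  apply: le_trans (key e e0 e1) _; rewrite addrC lerD2r.
  rewrite /e mulrAC ler_pdivrMr; last by lra.
  by rewrite ler_pM2l//; lra.
have [X_gt0|] := ltP 0 X; last by move=> h; exact: le_trans h S0.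
by move: hX; rewrite expr2 ler_pM2r.
Qed.

End FormalQuotient.

(** Bounded energy makes the formal quotient converge in the disc; its sum times [A z] is [B z], and
    invertibility of [A z] identifies it. *)
Lemma outer_factor (B : C -> 'rV[C]_n) (b : 'I_n -> nat -> C) S : 0 <= S ->
  (forall k, ps_rep (b k) (fun z => B z 0 k)) ->
  (forall w m E, (forall N, \sum_k \sum_(j < N) nc2 (row_app (al k) w j) <= E) ->
     nc2 (row_app b w m) <= S * E) ->
  forall k, H2 (fun z => (B z *m invmx (A z)) 0 k).
Proof.
move=> S0 Bb H; have hq := quot_energy S0 H.
have sq k N : \sum_(j < N) nc2 (quot b j 0 k) <= S.
  apply: le_trans (hq N); rewrite [leRHS](bigD1 k)//= lerDl.
  by apply: sumr_ge0 => i _; apply: sumr_ge0 => j _; exact: nc2_ge0.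
have /choice[f hf] k : exists f, ps_rep (fun j => quot b j 0 k) f.
  apply: (@ps_exists R _ (Num.sqrt S)) => j; rewrite ler_sqrt//.
  apply: le_trans (sq k j.+1); rewrite big_ord_recr/= lerDr.
  by apply: sumr_ge0 => i _; exact: nc2_ge0.
move=> k; exists (fun j => quot b j 0 k); split; last by exists S; exact: sq.
apply: ps_ext (hf k) => z zD.
suff <- : (\row_k f k z) *m A z = B z.
  by rewrite mulmxK ?mxE//; exact: outer_unitmx.
apply/rowP => l; rewrite mxE; under eq_bigr do rewrite mxE.
have h := ps_sum (index_enum 'I_n) (fun k (_ : true) => ps_mul (hf k) (Aal k l)).
apply: (cto_unique (ps_cto (ps_coef_ext (quot_conv b l) h) zD)).
exact: ps_cto (Bb l) zD.
Qed.

End OuterFactor.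

(** * The reproducing kernel form in Taylor coefficients *)

Section KernelForm.
Variable R : realType.
Local Notation C := R[i].
Variables (n : nat) (B : C -> 'rV[C]_n) (b : 'I_n -> nat -> C).
Hypothesis Bb : forall l, ps_rep (b l) (fun z => B z 0 l).

(** Taylor coefficients of the Szego combination [k = \sum_i cc i / (1 - conj (lam i) z)]. *)
Definition kcoef m (lam cc : 'I_m -> C) (q : nat) : C :=
  \sum_i cc i * conjc (lam i) ^+ q.

(** Coefficients of component [l] of [y = T_{B^*} k]: the adjoint of multiplication by [B_l] scales
    the Szego kernel at [lam i] by [conj (B_l (lam i))]. *)
Definition ycoef m (lam cc : 'I_m -> C) (l : 'I_n) : nat -> C :=
  kcoef lam (fun i => cc i * conjc (B (lam i) 0 l)).

Definition kform m (lam cc : 'I_m -> C) : R :=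
  Re (\sum_i \sum_j cc i * conjc (cc j) * KB B (lam j) (lam i)).

Lemma cto_geometric (x : C) : nc x < 1 -> cto (fun N => \sum_(q < N) x ^+ q) (1 - x)^-1.
Proof.
move=> x1; have nx : 1 - x != 0.
  by rewrite subr_eq0; apply: contraTneq x1 => <-; rewrite nc1 ltxx.
apply: (@cto_squeeze _ _ _ (fun N => nc (1 - x)^-1 * nc x ^+ N)) => [N|].
  have -> : \sum_(q < N) x ^+ q = (1 - x)^-1 * (1 - x ^+ N).
    by rewrite -[1 - x ^+ N]opprB subrX1 -[x - 1]opprB mulNr opprK mulKf.
  by rewrite mulrBr mulr1 addrAC subrr sub0r ncN ncM ncX.
rewrite -[X in _ --> X](mulr0 (nc (1 - x)^-1)); apply: cvgMr.
by apply: expr_cvg0 => //; exact: nc_ge0.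
Qed.

Lemma kcoef_mulJ m (lam cc cc' : 'I_m -> C) q :
  kcoef lam cc q * conjc (kcoef lam cc' q) =
  \sum_i \sum_j cc i * conjc (cc' j) * (lam j * conjc (lam i)) ^+ q.
Proof.
rewrite /kcoef conjc_sum mulr_suml; apply: eq_bigr => i _.
rewrite mulr_sumr; apply: eq_bigr => j _.
by rewrite rmorphM rmorphXn/= conjcK exprMn; ring.
Qed.

(** Reproducing property of the Szego kernel, through partial sums. *)
Lemma kcoef_pairing_cvg c f m (lam cc : 'I_m -> C) : ps_rep c f ->
  (forall i, inD (lam i)) ->
  cto (fun N => \sum_(q < N) c q * conjc (kcoef lam cc q)) (\sum_i conjc (cc i) * f (lam i)).
Proof.
move=> cf hl; have := @cto_sum R 'I_m (index_enum 'I_m) xpredT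
  (fun i N => conjc (cc i) * psum c (lam i) N) (fun i => conjc (cc i) * f (lam i)).
move=> /(_ (fun i _ => ctoZ _ (ps_cto cf (hl i)))).
apply: cto_ext; exists 0%N => N _.
under [RHS]eq_bigr do rewrite conjc_sum mulr_sumr.
rewrite exchange_big/=; apply: eq_bigr => i _; rewrite mulr_sumr.
by apply: eq_bigr => q _; rewrite rmorphM rmorphXn/= conjcK; ring.
Qed.

Lemma kcoef_le m (lam cc : 'I_m -> C) q : (forall i, inD (lam i)) ->
  nc (kcoef lam cc q) <= \sum_i nc (cc i).
Proof.
move=> hl; apply: le_trans (nc_sum _ _ _) _; apply: ler_sum => i _.
by rewrite ncM ncX nc_conj ler_piMr ?nc_ge0// exprn_ile1 ?nc_ge0//; exact/ltW/hl.
Qed.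

(** Expanding the denominators of [KB] in geometric series splits the form into [|k|^2 - |y|^2]. *)
Lemma kform_cvg m (lam cc : 'I_m -> C) : (forall i, inD (lam i)) ->
  \sum_(q < N) nc2 (kcoef lam cc q) - \sum_l \sum_(q < N) nc2 (ycoef lam cc l q)
    @[N --> \oo] --> kform lam cc.
Proof.
move=> hl.
have h : cto (fun N => \sum_i \sum_j cc i * conjc (cc j) *
    ((1 - (B (lam j) *m (map_mx conjc (B (lam i)))^T) 0 0) *
    \sum_(q < N) (lam j * conjc (lam i)) ^+ q))
    (\sum_i \sum_j cc i * conjc (cc j) * KB B (lam j) (lam i)).
  apply: cto_sum => i _; apply: cto_sum => j _; apply: ctoZ; apply: ctoZ.
  apply: cto_geometric; rewrite ncM nc_conj.
  have [h1 h2] := (hl i, hl j); rewrite /inD in h1 h2.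
  apply: le_lt_trans h2; rewrite ler_piMr ?nc_ge0//; exact: ltW.
rewrite (_ : (fun N => _ - _) = (fun N => Re (\sum_i \sum_j cc i * conjc (cc j) *
    ((1 - (B (lam j) *m (map_mx conjc (B (lam i)))^T) 0 0) *
    \sum_(q < N) (lam j * conjc (lam i)) ^+ q)))); first exact: cto_Re h.
apply/funext => N; rewrite exchange_big -sumrB/=.
have -> : \sum_i \sum_j cc i * conjc (cc j) *
    ((1 - (B (lam j) *m (map_mx conjc (B (lam i)))^T) 0 0) *
    \sum_(q < N) (lam j * conjc (lam i)) ^+ q) =
  \sum_(q < N) \sum_i \sum_j cc i * conjc (cc j) *
    ((1 - (B (lam j) *m (map_mx conjc (B (lam i)))^T) 0 0) *
     (lam j * conjc (lam i)) ^+ q).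
  rewrite [RHS]exchange_big/=; apply: eq_bigr => i _.
  rewrite [RHS]exchange_big/=; apply: eq_bigr => j _.
  by rewrite !mulr_sumr.
rewrite Re_sum; apply: eq_bigr => q _.
rewrite nc2E kcoef_mulJ (eq_bigr (fun l : 'I_n => Re (\sum_i \sum_j
   (cc i * conjc (B (lam i) 0 l)) * conjc (cc j * conjc (B (lam j) 0 l)) *
   (lam j * conjc (lam i)) ^+ q))); last first.
  by move=> l _; rewrite nc2E -kcoef_mulJ.
rewrite -Re_sum -Re_sub; congr Re.
rewrite [X in _ - X]exchange_big/= -sumrB; apply: eq_bigr => i _.
rewrite [X in _ - X]exchange_big/= -sumrB; apply: eq_bigr => j _.
rewrite mxE mulrBl mul1r mulrBr; congr (_ - _).
rewrite mulr_suml mulr_sumr; apply: eq_bigr => l _.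
by rewrite !mxE rmorphM/= conjcK; ring.
Qed.

(** Add [|y - w|^2 >= 0] to [|k|^2 - |y|^2] and replace [<y, w>] by [<k, B w>]: what results is
    [|k - B w|^2 + |w|^2 - |B w|^2], here bounded through its large partial sums. *)
Lemma kform_le m (lam cc : 'I_m -> C) (w : 'I_n -> {poly C}) (D : nat) (E : R) :
  (forall i, inD (lam i)) -> (forall l, (size (w l) <= D)%N) ->
  (exists N0, forall N, (N0 <= N)%N ->
    \sum_(q < N) nc2 (kcoef lam cc q - row_app b w q) -
    \sum_(q < N) nc2 (row_app b w q) + \sum_l \sum_(q < D) nc2 (w l)`_q <= E) ->
  kform lam cc <= E.
Proof.
move=> hl hD [N0 hE]; set u := row_app b w in hE *.
set W := \sum_l \sum_(q < D) nc2 (w l)`_q in hE *.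
pose U z := \sum_l B z 0 l * (w l).[z].
have uU : ps_rep u U by exact: ps_row_app.
pose P := \sum_i cc i * conjc (U (lam i)).
have ku : cto (fun N => \sum_(q < N) kcoef lam cc q * conjc (u q)) P.
  have := cto_conj (@kcoef_pairing_cvg _ _ _ lam cc uU hl).
  rewrite (_ : conjc _ = P); last first.
    by rewrite conjc_sum; apply: eq_bigr => i _; rewrite rmorphM/= conjcK.
  apply: cto_ext; exists 0%N => N _; rewrite conjc_sum; apply: eq_bigr => q _.
  by rewrite rmorphM/= conjcK mulrC.
have yw N : (D <= N)%N ->
    \sum_l \sum_(q < N) ycoef lam cc l q * conjc (w l)`_q = P.
  move=> DN; rewrite /P.
  have -> : \sum_i cc i * conjc (U (lam i)) =
     \sum_l \sum_i cc i * conjc (B (lam i) 0 l) * conjc (w l).[lam i].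
    rewrite exchange_big/=; apply: eq_bigr => i _; rewrite /U conjc_sum mulr_sumr.
    by apply: eq_bigr => l _; rewrite rmorphM/= mulrA.
  apply: eq_bigr => l _; rewrite /ycoef /kcoef.
  under eq_bigr do rewrite mulr_suml.
  rewrite exchange_big/=; apply: eq_bigr => i _.
  rewrite (horner_coef_wide _ (leq_trans (hD l) DN)) conjc_sum mulr_sumr.
  by apply: eq_bigr => q _; rewrite rmorphM rmorphXn/=; ring.
have h := @kform_cvg _ lam cc hl.
(* The added term tends to 0: [<y, w>] equals [P] as soon as [D <= N], whereas the partial sums of
   [<k, B w>] only tend to [P]. *)
have h2 : (\sum_(q < N) nc2 (kcoef lam cc q) - \sum_l \sum_(q < N) nc2 (ycoef lam cc l q)) +
   2 * (Re P - Re (\sum_(q < N) kcoef lam cc q * conjc (u q)))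
    @[N --> \oo] --> kform lam cc.
  rewrite -[X in _ --> X]addr0; apply: cvgD => //.
  rewrite -[X in _ --> X](mulr0 2) -(subrr (Re P)); apply: cvgMr.
  by apply: cvgB; [exact: cvg_cst|exact: cto_Re].
rewrite -(cvg_lim _ h2)//; apply: limr_le; first by apply/cvg_ex; eexists; exact: h2.
exists (maxn N0 D) => // N /=; rewrite geq_max => /andP[N0N DN].
apply: le_trans (hE N N0N).
have -> : W = \sum_l \sum_(q < N) nc2 (w l)`_q.
  apply: eq_bigr => l _; rewrite (big_ord_widen _ (fun q => nc2 (w l)`_q) DN).
  rewrite [RHS](bigID (fun q : 'I_N => (q < D)%N))/= [X in _ + X]big1 ?addr0// => q.
  by rewrite -leqNgt => Dq; rewrite nth_default ?nc20// (leq_trans (hD l)).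
have : 0 <= \sum_l \sum_(q < N) nc2 (ycoef lam cc l q - (w l)`_q).
  by apply: sumr_ge0 => l _; apply: sumr_ge0 => q _; exact: nc2_ge0.
have -> : \sum_l \sum_(q < N) nc2 (ycoef lam cc l q - (w l)`_q) =
  \sum_l \sum_(q < N) nc2 (ycoef lam cc l q) - 2 * Re P +
  \sum_l \sum_(q < N) nc2 (w l)`_q.
  rewrite -(yw N DN) Re_sum mulr_sumr -sumrB -big_split/=; apply: eq_bigr => l _.
  rewrite Re_sum mulr_sumr -sumrB -big_split/=; apply: eq_bigr => q _.
  by rewrite nc2B.
have -> : \sum_(q < N) nc2 (kcoef lam cc q - u q) =
   \sum_(q < N) nc2 (kcoef lam cc q) - 2 * Re (\sum_(q < N) kcoef lam cc q * conjc (u q)) +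
   \sum_(q < N) nc2 (u q).
  rewrite Re_sum mulr_sumr -sumrB -big_split/=; apply: eq_bigr => q _.
  by rewrite nc2B.
lra.
Qed.

(* Nodes [e * x_i] with [e] small: prescribing the first [N] coefficients is a
   Vandermonde system, and the later ones are [O(e)] because they carry at
   least one more power of [e] than the solution loses. *)
Lemma kernel_dense (u : nat -> C) (N : nat) (eps : R) : 0 < eps ->
  exists (lam cc : 'I_N -> C), [/\ (forall i, inD (lam i)),
    (forall q, (q < N)%N -> kcoef lam cc q = u q) &
    (forall M, \sum_(q < M) nc2 (kcoef lam cc (N + q)) <= eps)].
Proof.
move=> eps0.
pose xr (i : 'I_N) : R := i.+1%:R / N.+1%:R.
have xr0 i : 0 <= xr i by rewrite divr_ge0.
have xr1 i : xr i < 1 by rewrite ltr_pdivrMr// mul1r ltr_nat ltnS.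
pose x : 'rV[C]_N := \row_i (xr i)%:C.
pose V := Vandermonde N x.
have Vu : V \in unitmx.
  rewrite unitmxE det_Vandermonde unitfE; apply/prodf_neq0 => i _.
  apply/prodf_neq0 => j ij; rewrite !mxE subr_eq0 (inj_eq (@complexI R)).
  rewrite /xr (inj_eq (mulIf _)) ?invr_eq0 ?pnatr_eq0// eqr_nat eqSS.
  by rewrite gtn_eqF.
pose K := \sum_i \sum_(q < N) nc (invmx V i q) * nc (u q).
have K0 : 0 <= K.
  by apply: sumr_ge0 => i _; apply: sumr_ge0 => q _; rewrite mulr_ge0 ?nc_ge0.
(* Gives [e <= 1/2], so that powers of [e] sum to at most 2, and [2 K^2 e <= eps]. *)
pose e := eps / (2 * (eps + K ^+ 2 + 1)).
have D0 : 0 < 2 * (eps + K ^+ 2 + 1) by have := sqr_ge0 K; lra.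
have e0 : 0 < e by rewrite divr_gt0.
have e2 : e <= 2^-1 by rewrite ler_pdivrMr//; have := sqr_ge0 K; lra.
have eK : 2 * K ^+ 2 * e <= eps.
  rewrite /e mulrA ler_pdivrMr// mulrC ler_pM2l//; lra.
have e1 : e < 1 by lra.
clearbody e.
pose cc i : C := \sum_(q < N) invmx V i q * (u q * (e%:C ^+ q)^-1).
pose lam i : C := (e * xr i)%:C.
have eC : e%:C != 0 :> C by rewrite -(rmorph0 (real_complex R)) (inj_eq (@complexI R)) gt_eqF.
have lamX i q : conjc (lam i) ^+ q = e%:C ^+ q * (xr i)%:C ^+ q.
  by rewrite conjc_real /lam rmorphM/= exprMn.
exists lam, cc; split.
- move=> i; rewrite /inD nc_real ger0_norm ?mulr_ge0 ?(ltW e0)//.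
  by rewrite mulr_ilt1 ?(ltW e0).
- move=> q qN; pose q' := Ordinal qN.
  have /colP/(_ q') : V *m (\col_i cc i) = \col_p (u p * (e%:C ^+ p)^-1).
    rewrite (_ : \col_i cc i = invmx V *m \col_p (u p * (e%:C ^+ p)^-1)) ?mulKVmx//.
    by apply/colP => i; rewrite !mxE; apply: eq_bigr => p _; rewrite mxE.
  rewrite !mxE/= => h; rewrite /kcoef.
  under eq_bigr do rewrite lamX.
  rewrite (eq_bigr (fun i => e%:C ^+ q * (V q' i * (\col_i cc i) i 0))); last first.
    by move=> i _; rewrite !mxE/=; ring.
  by rewrite -mulr_sumr h mulrCA mulfV ?mulr1// expf_neq0.
- have kb q : nc (kcoef lam cc (N + q)) <= K * e ^+ q.+1.
    apply: le_trans (nc_sum _ _ _) _; rewrite /K mulr_suml; apply: ler_sum => i _.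
    rewrite lamX /cc mulr_suml; apply: le_trans (nc_sum _ _ _) _.
    rewrite mulr_suml; apply: ler_sum => p _.
    have pN : (p <= N + q)%N by rewrite (leq_trans (ltnW (ltn_ord p)))// leq_addr.
    have -> : invmx V i p * (u p * (e%:C ^+ p)^-1) * (e%:C ^+ (N + q) * (xr i)%:C ^+ (N + q))
        = invmx V i p * u p * (e%:C ^+ (N + q - p) * (xr i)%:C ^+ (N + q)).
      rewrite -{1}(subnK pN) exprD -[LHS]mulrA -[RHS]mulrA; congr (_ * _).
      rewrite -[LHS]mulrA; congr (_ * _).
      by rewrite mulrA [_ * e%:C ^+ p]mulrC mulKf// expf_neq0.
    rewrite !ncM !ncX !nc_real !ger0_norm ?(ltW e0)// ler_wpM2l ?mulr_ge0 ?nc_ge0//.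
    apply: (@le_trans _ _ (e ^+ (N + q - p) * 1)).
      by rewrite ler_wpM2l ?exprn_ge0 ?(ltW e0)// exprn_ile1// ltW.
    rewrite mulr1; apply: ler_wiXn2l; rewrite ?(ltW e0) ?(ltW e1)//.
    by have := ltn_ord p; lia.
  move=> M; apply: (@le_trans _ _ (\sum_(q < M) K ^+ 2 * e * e ^+ q)).
    apply: ler_sum => q _; rewrite -nc_sqr.
    apply: (@le_trans _ _ ((K * e ^+ q.+1) ^+ 2)).
      by rewrite lerXn2r ?nnegrE ?nc_ge0 ?mulr_ge0 ?exprn_ge0 ?(ltW e0)// kb.
    rewrite exprMn -mulrA ler_wpM2l ?sqr_ge0// -exprS expr2.
    by rewrite ger_pMl ?exprn_gt0// exprn_ile1 ?(ltW e0) ?(ltW e1).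
  rewrite -mulr_sumr; apply: (@le_trans _ _ (K ^+ 2 * e * 2)); last by lra.
  rewrite ler_wpM2l ?mulr_ge0 ?sqr_ge0 ?(ltW e0)//.
  apply: le_trans (geo_sum M (ltW e0) e1) _.
  by rewrite -[leRHS]invrK lef_pV2 ?posrE; lra.
Qed.

(** A kernel combination [k] matching the first coefficients of [u = B w], with small tail, pairs
    with [z^m] to [conj (u m)], and [kform_le] bounds its form by [|w|^2 - |u|^2] up to tails. *)
Lemma monomials_bound (M : R) (w : 'I_n -> {poly C}) (D m : nat) (U : R) :
  (forall p, inHB_le B (fun z => z ^+ p) M) -> (forall l, (size (w l) <= D)%N) ->
  \sum_(q < N) nc2 (row_app b w q) @[N --> \oo] --> U ->
  nc2 (row_app b w m) <= M ^+ 2 * (\sum_l \sum_(q < D) nc2 (w l)`_q - U).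
Proof.
move=> hM hD hU; set u := row_app b w in hU *.
have uU N : \sum_(q < N) nc2 (u q) <= U.
  rewrite -(cvg_lim _ hU)//; apply: nondecreasing_cvgn_le; last by apply/cvg_ex; eexists; exact: hU.
  apply/nondecreasing_seqP => k; rewrite big_ord_recr/= lerDl; exact: nc2_ge0.
set W := \sum_l _.
apply/ler_addgt0Pl => d d0.
(* Five tails are lost: four in [|k - u|^2], one in truncating [|u|^2]. *)
pose eps := d / (5 * (M ^+ 2 + 1)).
have M0 : 0 < 5 * (M ^+ 2 + 1) by have := sqr_ge0 M; lra.
have eps0 : 0 < eps by rewrite divr_gt0.
have epsd : 5 * M ^+ 2 * eps <= d.
  by rewrite /eps mulrA ler_pdivrMr// mulrC ler_pM2l//; lra.
move/cvgrPdist_lt : hU => /(_ _ eps0)[N1 _ hN1].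
pose N0 := (maxn N1 m.+1).
have mN0 : (m < N0)%N by rewrite leq_max leqnn orbT.
have tail N : \sum_(q < N) nc2 (u (N0 + q)%N) <= eps.
  have := uU (N0 + N)%N; rewrite big_split_ord/= => h1.
  have := hN1 N0 (leq_maxl _ _); rewrite ger0_norm ?subr_ge0// => h2; lra.
have [lam [cc [hl hk ht]]] := kernel_dense u N0 eps0.
have := hM m N0 lam cc hl.
have -> : \sum_i conjc (cc i) * lam i ^+ m = conjc (u m).
  rewrite -hk// /kcoef conjc_sum; apply: eq_bigr => i _.
  by rewrite rmorphM rmorphXn/= conjcK.
rewrite nc2_conj -/(kform lam cc) => h; apply: le_trans h _.
have : kform lam cc <= W - U + 5 * eps.
  apply: (@kform_le _ lam cc w D) => //; exists N0 => N N0N.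
  rewrite -/u -(subnKC N0N) !big_split_ord/= big1; last first.
    by move=> q _; rewrite hk// subrr nc20.
  rewrite add0r.
  have h1 : \sum_(q < N - N0) nc2 (kcoef lam cc (N0 + q) - u (N0 + q)%N) <= 4 * eps.
    apply: (@le_trans _ _ (2 * \sum_(q < N - N0) nc2 (kcoef lam cc (N0 + q)) +
        2 * \sum_(q < N - N0) nc2 (u (N0 + q)%N))).
      rewrite !mulr_sumr -big_split/=; apply: ler_sum => q _.
      have := nc2D_le (kcoef lam cc (N0 + q)) (- u (N0 + q)%N) (@ltr01 R).
      by rewrite nc2N invr1.
    have := ht (N - N0)%N; have := tail (N - N0)%N; lra.
  have h2 : 0 <= \sum_(q < N - N0) nc2 (u (N0 + q)%N).
    by apply: sumr_ge0 => q _; exact: nc2_ge0.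
  have := hN1 N0 (leq_maxl _ _); rewrite ger0_norm ?subr_ge0// => h3.
  rewrite -/W; lra.
move=> hkf; apply: (@le_trans _ _ (M ^+ 2 * (W - U + 5 * eps))).
  by rewrite ler_wpM2l// sqr_ge0.
lra.
Qed.

End KernelForm.

(** * Weighted estimates on the circle *)

Section Boundary.
Variable R : realType.
Local Notation C := R[i].
Local Notation mu := (@lebesgue_measure R).
Local Notation T := `[0, 2 * pi]%classic.

Lemma cto_horner (p : {poly C}) (t : R) :
  cto (fun m => p.[(rad R m)%:C * expi t]) p.[expi t].
Proof.
rewrite horner_coef.
have := @cto_sum R 'I_(size p) (index_enum _) xpredT
  (fun j m => p`_j * ((rad R m)%:C ^+ j * expi t ^+ j)) (fun j => p`_j * (1 * expi t ^+ j)).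
move=> /(_ (fun j _ => ctoZ _ (ctoM (cto_radX j) (cto_cst _)))).
under [X in cto _ X]eq_bigr do rewrite mul1r.
apply: cto_ext; exists 0%N => m _; rewrite horner_coef.
by apply: eq_bigr => j _; rewrite exprMn.
Qed.

Lemma horner_disc_le (p : {poly C}) z : nc z <= 1 -> nc p.[z] <= \sum_(j < size p) nc p`_j.
Proof.
move=> z1; rewrite horner_coef; apply: le_trans (nc_sum _ _ _) _.
by apply: ler_sum => j _; rewrite ncM ncX ler_piMr ?nc_ge0// exprn_ile1 ?nc_ge0.
Qed.

Lemma bmfC_horner (p : {poly C}) : bmfC (fun t => p.[expi t]).
Proof.
by under eq_fun do rewrite horner_coef; exact: (bmfC_psum (fun j => p`_j) (size p)).
Qed.

Lemma radial_liminf_cvg n (u : 'I_n -> C -> C) (v : 'I_n -> C) (t x : R) :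
  (forall k, cto (fun m => u k ((rad R m)%:C * expi t)) (v k)) ->
  x <= \sum_k nc2 (v k) -> radial_liminf_ge u t x.
Proof.
move=> h xv e e0; have := @cvgr_sum R _ (index_enum 'I_n) _ _ (fun k => cto_nc2 (h k)).
move=> /cvgrPdist_lt/(_ _ e0)[N _ hN]; exists N => m /hN.
by rewrite ltr_norml => /andP[_ h1]; lra.
Qed.

(** Here [g] stands for a weight such as [1 / (1 - beta)], integrable but possibly outside [bmf]. *)
Lemma cmean_le_add (f g h : R -> R) (x : R) : bmf f -> mu.-integrable T (EFin \o g) ->
  bmf h -> ae_circle (fun t => f t <= x * g t + h t) ->
  cmean f <= x * cmean g + cmean h.
Proof.
move=> bf ig bh fgh; pose k t := x * g t + h t - f t.
have i1 : mu.-integrable T (EFin \o (fun t => x * g t)).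
  by have := @integrableZl _ _ R mu T (measurable_itv _) x (EFin \o g) ig.
have i2 : mu.-integrable T (EFin \o (fun t => x * g t + h t)).
  by have := @integrableD _ _ R mu T (measurable_itv _) _ _ i1 (bmf_integrable bh).
have i3 : mu.-integrable T (EFin \o k).
  by have := @integrableB _ _ R mu T (measurable_itv _) _ _ i2 (bmf_integrable bf).
have ek : cmean k = x * cmean g + cmean h - cmean f.
  rewrite /cmean /k RintegralB; [|exact: measurable_circle|exact: i2|exact: bmf_integrable].
  rewrite RintegralD; [|exact: measurable_circle|exact: i1|exact: bmf_integrable].
  rewrite RintegralZl; [|exact: measurable_circle|exact: ig].
  set p := (_^-1); move: p => p; ring.
have : 0 <= cmean k.
  rewrite /cmean mulr_ge0 ?invr_ge0 ?(ltW (twopi_gt0 R))//.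
  have mk : measurable_fun T (EFin \o k) by exact: measurable_int i3.
  rewrite /Rintegral (@ae_eq_integral _ _ _ mu T (fun t => `|(k t)%:E|)%E)//.
  - by rewrite fine_ge0// integral_ge0.
  - exact: measurableT_comp.
  - move: fgh; apply: (@filterS _ _ (ae_filter_ringOfSetsType mu)) => t h' tT /=.
    by rewrite ger0_norm// subr_ge0 h'.
by rewrite ek subr_ge0.
Qed.

(** Cauchy-Schwarz derived from the pointwise bound [|k| <= a / (2 s) + s |k|^2 / (2 a)], in which
    the unbounded [1 / s] enters linearly. *)
Lemma cmean_nc_sqr_le (s : R -> R) (k : R -> C) : bmf s ->
  ae_circle (fun t => 0 < s t /\ s t <= 1) ->
  mu.-integrable T (EFin \o (fun t => (s t)^-1)) -> bmfC k ->
  cmean (fun t => nc (k t)) ^+ 2 <=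
  cmean (fun t => (s t)^-1) * cmean (fun t => s t * nc2 (k t)).
Proof.
move=> bs hs iV bk; set V := cmean (fun t => (s t)^-1).
set X := cmean (fun t => nc (k t)); set Y := cmean (fun t => s t * nc2 (k t)).
have bY : bmf (fun t => s t * nc2 (k t)) by apply: bmfM => //; exact: bmfC_nc2.
have V1 : 1 <= V.
  have := @cmean_le_add (fun=> 1) (fun t => (s t)^-1) (fun=> 0) 1 (bmf_cst 1) iV (bmf_cst 0).
  rewrite !cmean_cst mul1r addr0; apply; apply: ae_circleS hs => t [s0 s1].
  by rewrite mul1r addr0 -invr1 lef_pV2 ?posrE.
have X0 : 0 <= X.
  by apply: cmean_ge0; [exact: bmfC_nc|apply: ae_circleW => t; exact: nc_ge0].
have Y0 : 0 <= Y.
  apply: cmean_ge0 => //; apply: ae_circleS hs => t [s0 _].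
  by rewrite mulr_ge0 ?(ltW s0) ?nc2_ge0.
have key a : 0 < a -> X <= a / 2 * V + (2 * a)^-1 * Y.
  move=> a0; have -> : (2 * a)^-1 * Y = cmean (fun t => (2 * a)^-1 * (s t * nc2 (k t))).
    by rewrite cmeanZ.
  apply: cmean_le_add => //.
  - exact: bmfC_nc.
  - by apply: bmfM (bmf_cst _) bY.
  - apply: ae_circleS hs => t [s0 _]; rewrite -nc_sqr.
    set x := nc (k t); set y := s t.
    have -> : a / 2 * y^-1 + (2 * a)^-1 * (y * x ^+ 2) = x + (a - y * x) ^+ 2 / (2 * a * y).
      by field; rewrite !gt_eqF.
    by rewrite lerDl divr_ge0 ?sqr_ge0// !mulr_ge0 ?(ltW a0) ?(ltW s0).
have [X_gt0|] := ltP 0 X; last first.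
  move=> Xle; have -> : X = 0 by apply/eqP; rewrite eq_le Xle.
  by rewrite expr0n mulr_ge0// (le_trans _ V1).
have V0 : 0 < V by apply: lt_le_trans V1.
(* With [a = X / V] the bound reads [X <= X / 2 + V Y / (2 X)]. *)
have := key (X / V) (divr_gt0 X_gt0 V0).
have -> : X / V / 2 * V + (2 * (X / V))^-1 * Y = X / 2 + (V * Y) / (2 * X).
  by field; rewrite !gt_eqF.
move=> h; have : X / 2 <= (V * Y) / (2 * X) by lra.
have X20 : 0 < 2 * X by rewrite mulr_gt0.
move=> /(ler_wpM2r (ltW X20)); rewrite divfK ?gt_eqF//.
by rewrite (_ : X / 2 * (2 * X) = X ^+ 2)//; field.
Qed.

(** The estimate is made on circles inside the disc, where [|f| <= F] holds everywhere, after
    rotating the sum to be real; then the radius tends to 1 in finitely many coefficients. *)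
Lemma ps_pairing_le c f (F : R) (d : nat -> C) N : ps_rep c f ->
  (forall z, inD z -> nc (f z) <= F) ->
  nc (\sum_(q < N) c q * conjc (d q)) <= F * cmean (fun t => nc (psum d (expi t) N)).
Proof.
move=> cf fF.
have bn : bmf (fun t => nc (psum d (expi t) N)) by apply: bmfC_nc; exact: bmfC_psum.
have F0 : 0 <= F by apply: le_trans (nc_ge0 _) (fF 0 _); rewrite /inD nc0 ltr01.
have h m : nc (\sum_(q < N) dil c (rad R m) q * conjc (d q)) <=
    F * cmean (fun t => nc (psum d (expi t) N)).
  set s := \sum_(q < N) _.
  have [->|s0] := eqVneq s 0.
    rewrite nc0 mulr_ge0//; apply: cmean_ge0 => //.
    by apply: ae_circleW => t; exact: nc_ge0.
  have ns : nc s != 0 by rewrite nc_eq0.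
  pose w := (nc s)^-1%:C * s.
  have nw : nc w = 1 by rewrite ncM nc_real ger0_norm ?invr_ge0 ?nc_ge0// mulVf.
  have <- : Re (s * conjc w) = nc s.
    by rewrite Re_mulJC -mulrA Re_realM -nc2E -nc_sqr expr2 mulrA mulVf// mul1r.
  clearbody w.
  have -> : s * conjc w = \sum_(q < N) dil c (rad R m) q * conjc (w * d q).
    by rewrite mulr_suml; apply: eq_bigr => q _; rewrite rmorphM/=; ring.
  rewrite -(ps_pairing (fun q => w * d q) N cf (rad_ge0 R m) (rad_lt1 R m)).
  have -> : F * cmean (fun t => nc (psum d (expi t) N)) =
      cmean (fun t => F * nc (psum d (expi t) N)) by rewrite cmeanZ.
  apply: cmean_le.
  - apply: bmfC_Re_mulJ (bmfC_psum _ _).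
    exact: bmfC_circle cf (rad_ge0 R m) (rad_lt1 R m).
  - exact: bmfM (bmf_cst _) bn.
  - apply: ae_circleW => t; apply: le_trans (Re_le_nc _) _; rewrite ncM nc_conj.
    have -> : psum (fun q => w * d q) (expi t) N = w * psum d (expi t) N.
      by rewrite mulr_sumr; apply: eq_bigr => q _; rewrite mulrA.
    by rewrite ncM nw mul1r ler_wpM2r ?nc_ge0// fF//; exact: rad_circle.
apply: (cto_nc_le (u := fun m => \sum_(q < N) dil c (rad R m) q * conjc (d q))) => //.
apply: cto_sum => j _; rewrite -[X in cto _ (X * _)]mulr1; apply: ctoM (cto_cst _).
exact: ctoZ (cto_radX j).
Qed.

Variables (n : nat) (B : C -> 'rV[C]_n) (b : 'I_n -> nat -> C) (Bd : R -> 'rV[C]_n).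
Hypothesis schurB : schur_row B.
Hypothesis Bb : forall l, ps_rep (b l) (fun z => B z 0 l).
Hypothesis mRe : forall k, measurable_fun T (fun t => Re (Bd t 0 k)).
Hypothesis mIm : forall k, measurable_fun T (fun t => Im (Bd t 0 k)).
Hypothesis Blim : ae_circle (fun t => forall k, radial_lim (fun z => B z 0 k) t (Bd t 0 k)).
Hypothesis Blt1 : ae_circle (fun t => 0 < 1 - \sum_(k < n) nc2 (Bd t 0 k)).

Definition beta (t : R) : R := \sum_(k < n) nc2 (Bd t 0 k).

Lemma beta_ge0 t : 0 <= beta t.
Proof. by apply: sumr_ge0 => k _; exact: nc2_ge0. Qed.

Lemma nc2_le_sum (x : 'I_n -> C) k : nc2 (x k) <= \sum_k nc2 (x k).
Proof.
by rewrite [leRHS](bigD1 k)//= lerDl; apply: sumr_ge0 => i _; exact: nc2_ge0.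
Qed.

Lemma bmfC_Bd k : bmfC (fun t => Bd t 0 k).
Proof.
apply: (@bmfC_of_measurable _ _ 1) => //; apply: ae_circleS Blt1 => t h.
rewrite -(sqrtr1 R) ler_sqrt//; apply: le_trans (nc2_le_sum (Bd t 0) k) _; lra.
Qed.

Lemma bmf_1beta : bmf (fun t => 1 - beta t).
Proof.
by apply: bmfB (bmf_cst _) _; apply: bmf_sum => k; apply: bmfC_nc2; exact: bmfC_Bd.
Qed.

Lemma ae_1beta : ae_circle (fun t => 0 < 1 - beta t /\ 1 - beta t <= 1).
Proof. by apply: ae_circleS Blt1 => t h; split => //; have := beta_ge0 t; lra. Qed.

Lemma cmean_inv_1beta_ge0 : mu.-integrable T (EFin \o (fun t => (1 - beta t)^-1)) ->
  0 <= cmean (fun t => (1 - beta t)^-1).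
Proof.
move=> iV.
have := @cmean_le_add (fun=> 0) (fun t => (1 - beta t)^-1) (fun=> 0) 1 (bmf_cst 0) iV (bmf_cst 0).
rewrite !cmean_cst mul1r addr0; apply; apply: ae_circleS ae_1beta => t [s0 s1].
by rewrite mul1r addr0 invr_ge0 ltW.
Qed.

Implicit Types w : 'I_n -> {poly C}.

Definition row_bd w (t : R) : C := \sum_l Bd t 0 l * (w l).[expi t].

Lemma bmfC_row_bd w : bmfC (row_bd w).
Proof.
by apply: bmfC_sum => l; apply: bmfC_M; [exact: bmfC_Bd|exact: bmfC_horner].
Qed.

Lemma row_app_disc_le w :
  exists M, forall z, inD z -> nc (\sum_l B z 0 l * (w l).[z]) <= M.
Proof.
exists (\sum_l \sum_(j < size (w l)) nc (w l)`_j) => z zD.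
apply: le_trans (nc_sum _ _ _) _; apply: ler_sum => l _; rewrite ncM -[leRHS]mul1r.
apply: ler_pM; rewrite ?nc_ge0 ?horner_disc_le//; last exact: ltW.
rewrite -(sqrtr1 R) ler_sqrt//.
exact: le_trans (nc2_le_sum (B z 0) l) (schurB.2 z zD).
Qed.

Lemma row_bd_cto w : ae_circle (fun t =>
  cto (fun m => \sum_l B ((rad R m)%:C * expi t) 0 l * (w l).[(rad R m)%:C * expi t]) (row_bd w t)).
Proof.
apply: ae_circleS Blim => t h; apply: cto_sum => l _; apply: ctoM (cto_horner _ _).
exact: (radial_lim_cto (h l)).
Qed.

Lemma row_bd_pairing w d N :
  cmean (fun t => Re (row_bd w t * conjc (psum d (expi t) N))) =
  Re (\sum_(j < N) row_app b w j * conjc (d j)).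
Proof.
have [M hM] := row_app_disc_le w.
exact: hardy_boundary (ps_row_app w Bb) hM (bmfC_row_bd w) (row_bd_cto w).
Qed.

Lemma nc2_row_bd w t : nc2 (row_bd w t) <= beta t * \sum_l nc2 (w l).[expi t].
Proof. exact: nc2_sumM_le. Qed.

(** A coefficient is at most the mean of [|B w|], to which weighted Cauchy-Schwarz applies with
    [s = 1 - beta]. *)
Lemma row_app_sqr_le w m : mu.-integrable T (EFin \o (fun t => (1 - beta t)^-1)) ->
  nc2 (row_app b w m) <= cmean (fun t => (1 - beta t)^-1) *
    cmean (fun t => (1 - beta t) * nc2 (row_bd w t)).
Proof.
move=> iV; apply: le_trans (cmean_nc_sqr_le bmf_1beta ae_1beta iV (bmfC_row_bd w)).
have [M hM] := row_app_disc_le w.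
rewrite -nc_sqr lerXn2r ?nnegrE ?nc_ge0//.
  apply: cmean_ge0; first exact/bmfC_nc/bmfC_row_bd.
  by apply: ae_circleW => t; exact: nc_ge0.
exact: hardy_coef_le (ps_row_app w Bb) hM (bmfC_row_bd w) (row_bd_cto w).
Qed.

Lemma kform_ge m (lam cc : 'I_m -> C) f (fc : nat -> C) (F : R) :
  mu.-integrable T (EFin \o (fun t => (1 - beta t)^-1)) ->
  (forall i, inD (lam i)) -> ps_rep fc f -> (forall z, inD z -> nc (f z) <= F) ->
  nc2 (\sum_i conjc (cc i) * f (lam i)) <=
  F ^+ 2 * cmean (fun t => (1 - beta t)^-1) * kform B lam cc.
Proof.
move=> iV hl fcf fF; set V := cmean _.
have F0 : 0 <= F by apply: le_trans (nc_ge0 _) (fF 0 _); rewrite /inD nc0 ltr01.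
have V0 : 0 <= V by exact: cmean_inv_1beta_ge0.
pose k := kcoef lam cc; pose y := ycoef B lam cc.
have /choice[Y hY] l : exists f, ps_rep (y l) f by exact: (ps_exists (fun q => kcoef_le _ q hl)).
(* Truncating [y] at [N] leaves the coefficients of [B y] below [N] unchanged, and only these pair
   with the truncated [k]. *)
pose w N l : {poly C} := \poly_(q < N) y l q.
have wE N l t : (w N l).[expi t] = psum (y l) (expi t) N.
  by rewrite (horner_coef_wide _ (size_poly _ _)); apply: eq_bigr => q _; rewrite coef_poly ltn_ord.
have rowE N q : (q < N)%N -> row_app b (w N) q = \sum_l conv (b l) (y l) q.
  move=> qN; apply: eq_bigr => l _; apply: eq_bigr => j _.
  by rewrite coef_poly (leq_ltn_trans (leq_subr _ _) qN).
pose E N := cmean (fun t => nc2 (psum k (expi t) N)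
  - 2 * Re (row_bd (w N) t * conjc (psum k (expi t) N)) + \sum_l nc2 (psum (y l) (expi t) N)).
have bk N := bmfC_psum k N.
have by_ l N := bmfC_psum (y l) N.
have b1 N := bmfC_nc2 (bk N).
have b2 N := bmfC_Re_mulJ (bmfC_row_bd (w N)) (bk N).
have b2' N := bmfM (bmf_cst 2) (b2 N).
have b3 N : bmf (fun t => \sum_l nc2 (psum (y l) (expi t) N)).
  by apply: bmf_sum => l; exact: bmfC_nc2.
have b12 N := bmfB (b1 N) (b2' N).
have parsev (c : nat -> C) N :
    cmean (fun t => nc2 (psum c (expi t) N)) = \sum_(q < N) nc2 (c q).
  under eq_fun do rewrite nc2E.
  by rewrite cmean_parseval// Re_sum; apply: eq_bigr => q _; rewrite nc2E.
(* The first bracket tends to the form. The second tends to 0, since [|y|^2] and [Re <B y, k>] have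
   the same limit. *)
have EN N : E N = (\sum_(q < N) nc2 (k q) - \sum_l \sum_(q < N) nc2 (y l q)) +
    2 * (\sum_l \sum_(q < N) nc2 (y l q) -
         Re (\sum_l \sum_(q < N) conv (b l) (y l) q * conjc (k q))).
  rewrite /E cmeanD// cmeanB// cmeanZ// parsev row_bd_pairing.
  rewrite cmean_sum; last by move=> l; exact: bmfC_nc2.
  under [X in _ + X]eq_bigr do rewrite parsev.
  rewrite (eq_bigr (fun q : 'I_N => \sum_l conv (b l) (y l) q * conjc (k q))); last first.
    by move=> q _; rewrite rowE// mulr_suml.
  by rewrite exchange_big/=; ring.
have cE : E N @[N --> \oo] --> kform B lam cc.
  rewrite (funext EN) -[X in _ --> X]addr0; apply: cvgD; first exact: kform_cvg.
  pose L l := \sum_i conjc (cc i) * (B (lam i) 0 l * Y l (lam i)).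
  have L0 : 0 = 2 * (Re (\sum_l L l) - Re (\sum_l L l)) by rewrite subrr mulr0.
  rewrite [X in _ --> X]L0; apply: cvgMr.
  apply: cvgB; last first.
    apply: cto_Re; apply: cto_sum => l _.
    exact: (@kcoef_pairing_cvg R _ _ _ lam cc (ps_mul (Bb l) (hY l)) hl).
  rewrite [X in _ --> X](@Re_sum R _ _ _ L).
  apply: (@cvgr_sum R _ _ (fun l N => \sum_(q < N) nc2 (y l q)) (fun l => Re (L l))) => l.
  have := @kcoef_pairing_cvg R _ _ _ lam (fun i => cc i * conjc (B (lam i) 0 l)) (hY l) hl.
  rewrite (_ : \sum_i _ = L l); last first.
    by apply: eq_bigr => i _; rewrite rmorphM/= conjcK mulrA.
  move/cto_Re; rewrite (_ : (fun N => _) = (fun N => \sum_(q < N) nc2 (y l q)))//.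
  by apply/funext => N; rewrite Re_sum; apply: eq_bigr => q _; rewrite nc2E.
have hN N : nc2 (\sum_(q < N) fc q * conjc (k q)) <= F ^+ 2 * V * E N.
  have h1 := ps_pairing_le k N fcf fF.
  rewrite -nc_sqr.
  apply: (@le_trans _ _ ((F * cmean (fun t => nc (psum k (expi t) N))) ^+ 2)).
    rewrite lerXn2r ?nnegrE ?nc_ge0//; exact: le_trans (nc_ge0 _) h1.
  rewrite exprMn -mulrA ler_wpM2l ?sqr_ge0//.
  apply: le_trans (cmean_nc_sqr_le bmf_1beta ae_1beta iV (bk N)) _.
  rewrite ler_wpM2l//; apply: cmean_le; first exact: bmfM bmf_1beta (b1 N).
    exact: bmfD (b12 N) (b3 N).
  apply: ae_circleS ae_1beta => t [_ _].
  set z := psum k _ _; rewrite (eq_bigr (fun l => nc2 (w N l).[expi t])); last first.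
    by move=> l _; rewrite wE.
  (* The integrand of [E N] is this square plus [(1 - beta) |z|^2]. *)
  have : 0 <= \sum_l nc2 ((w N l).[expi t] - conjc (Bd t 0 l) * z).
    by apply: sumr_ge0 => l _; exact: nc2_ge0.
  have -> : \sum_l nc2 ((w N l).[expi t] - conjc (Bd t 0 l) * z) =
     \sum_l nc2 (w N l).[expi t] - 2 * Re (row_bd (w N) t * conjc z) + beta t * nc2 z.
    rewrite /row_bd mulr_suml Re_sum mulr_sumr /beta mulr_suml -sumrB -big_split/=.
    apply: eq_bigr => l _; rewrite nc2B nc2M nc2_conj rmorphM/= conjcK.
    by congr (_ - 2 * Re _ + _); ring.
  lra.
have c1 := cto_nc2 (@kcoef_pairing_cvg R _ _ _ lam cc fcf hl).
have c2 : F ^+ 2 * V * E N @[N --> \oo] --> F ^+ 2 * V * kform B lam cc by exact: cvgMr.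
by apply: ler_cvg_to c1 c2 _; exact: nearW.
Qed.

(** * Criteria linking the weight, the monomials and the quotient by an outer matrix *)

Section Quotient.
Variables (A : C -> 'M[C]_n) (al : 'I_n -> 'I_n -> nat -> C) (Ad : R -> 'M[C]_n).
Hypothesis outA : outer_mx A.
Hypothesis Aal : forall i j, ps_rep (al i j) (fun z => A z i j).
Hypothesis Alim : ae_circle (fun t => forall i j, radial_lim (fun z => A z i j) t (Ad t i j)).

Let fatouA w (E : R) (G : R -> R) :
  (forall N, \sum_k \sum_(j < N) nc2 (row_app (al k) w j) <= E) -> bmf G ->
  ae_circle (fun t => G t <= \sum_k nc2 (\sum_l Ad t k l * (w l).[expi t])) -> cmean G <= E.
Proof.
move=> hE bG hG; apply: (hardy_fatou (fun k => ps_row_app w (Aal k)) hE bG).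
apply: ae_circleS (ae_circleI Alim hG) => t [h GE].
apply: radial_liminf_cvg GE => k; apply: cto_sum => l _; apply: ctoM (cto_horner _ _).
exact: (radial_lim_cto (h k l)).
Qed.

(** On the circle [(1 - beta) |B w|^2 <= (1 - beta) |w|^2 <= |A w|^2], so the weight left by
    Cauchy-Schwarz is absorbed by [A w]. *)
Lemma integrable_quotient_H2 :
  ae_circle (fun t => forall x : 'I_n -> C,
    (1 - beta t) * \sum_l nc2 (x l) <= \sum_k nc2 (\sum_l Ad t k l * x l)) ->
  mu.-integrable T (EFin \o (fun t => (1 - beta t)^-1)) ->
  forall k, H2 (fun z => (B z *m invmx (A z)) 0 k).
Proof.
move=> hA iV; set V := cmean (fun t => (1 - beta t)^-1).
have V0 : 0 <= V by exact: cmean_inv_1beta_ge0.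
apply: (outer_factor outA Aal V0 Bb) => w m E hE.
apply: le_trans (row_app_sqr_le w m iV) _; rewrite -/V ler_wpM2l//.
apply: fatouA hE _ _; first by apply: bmfM bmf_1beta _; exact/bmfC_nc2/bmfC_row_bd.
apply: ae_circleS (ae_circleI ae_1beta hA) => t [[s0 s1] h].
apply: le_trans (h (fun l => (w l).[expi t])); rewrite ler_wpM2l ?(ltW s0)//.
apply: le_trans (nc2_row_bd w t) _; rewrite ler_piMl//; last by lra.
by apply: sumr_ge0 => l _; exact: nc2_ge0.
Qed.

(** The factor [|w|^2 - U] of [monomials_bound] is at most [E] by two uses of Fatou: the mean of
    [|B w|^2] is at most [U], and that of [|w|^2 - |B w|^2], which lies below [|A w|^2], is at most
    [E]. *)
Lemma monomials_quotient_H2 (M : R) :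
  ae_circle (fun t => forall x : 'I_n -> C,
    \sum_l nc2 (x l) - nc2 (\sum_l Bd t 0 l * x l) <= \sum_k nc2 (\sum_l Ad t k l * x l)) ->
  (forall m, inHB_le B (fun z => z ^+ m) M) ->
  forall k, H2 (fun z => (B z *m invmx (A z)) 0 k).
Proof.
move=> hA hM; apply: (outer_factor outA Aal (sqr_ge0 M) Bb) => w m E hE.
pose D := \max_l size (w l).
have hD l : (size (w l) <= D)%N by exact: leq_bigmax.
set u := row_app b w.
have [K hK] := row_app_disc_le w.
have uK := hardy_bessel (ps_row_app w Bb) hK.
pose U := limn (fun N => \sum_(q < N) nc2 (u q)).
have nd : nondecreasing_seq (fun N => \sum_(q < N) nc2 (u q)).
  by apply/nondecreasing_seqP => N; rewrite big_ord_recr/= lerDl nc2_ge0.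
have cU : \sum_(q < N) nc2 (u q) @[N --> \oo] --> U.
  by apply: (nondecreasing_is_cvgn nd); exists (K ^+ 2) => _ [N _ <-]; exact: uK.
have uU N : \sum_(q < N) nc2 (u q) <= U.
  by apply: (nondecreasing_cvgn_le nd); apply/cvg_ex; exists U.
apply: le_trans (monomials_bound Bb m hM hD cU) _; rewrite ler_wpM2l ?sqr_ge0//.
have bw l : bmf (fun t => nc2 (w l).[expi t]) by exact/bmfC_nc2/bmfC_horner.
have bW : bmf (fun t => \sum_l nc2 (w l).[expi t]) by exact: bmf_sum.
have bU : bmf (fun t => nc2 (row_bd w t)) by exact/bmfC_nc2/bmfC_row_bd.
have hW : cmean (fun t => \sum_l nc2 (w l).[expi t]) = \sum_l \sum_(q < D) nc2 (w l)`_q.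
  rewrite cmean_sum//; apply: eq_bigr => l _.
  rewrite (_ : (fun t => _) = (fun t => Re (psum (fun j => (w l)`_j) (expi t) D *
      conjc (psum (fun j => (w l)`_j) (expi t) D)))).
    by rewrite cmean_parseval// Re_sum; apply: eq_bigr => q _; rewrite nc2E.
  by apply/funext => t; rewrite (horner_coef_wide _ (hD l)) nc2E.
have hU : cmean (fun t => nc2 (row_bd w t)) <= U.
  apply: (@hardy_fatou _ 1 (fun=> u) (fun=> fun z => \sum_l B z 0 l * (w l).[z])) => //.
  - by move=> _; exact: ps_row_app.
  - by move=> N; rewrite big_ord_recl big_ord0 addr0.
  - apply: ae_circleS (row_bd_cto w) => t h.
    apply: (@radial_liminf_cvg 1 _ (fun=> row_bd w t)) => //.
    by rewrite big_ord_recl big_ord0 addr0.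
have : cmean (fun t => \sum_l nc2 (w l).[expi t] - nc2 (row_bd w t)) <= E.
  apply: fatouA hE _ _; first exact: bmfB.
  by apply: ae_circleS hA => t; apply.
rewrite cmeanB// hW; lra.
Qed.

Lemma quotient_H2_integrable :
  ae_circle (fun t => \sum_k nc2 (\sum_l Ad t k l * conjc (Bd t 0 l)) <= beta t * (1 - beta t)) ->
  (forall k, H2 (fun z => (B z *m invmx (A z)) 0 k)) ->
  mu.-integrable T (EFin \o (fun t => (1 - beta t)^-1)).
Proof.
move=> hA /choice[c hc].
have /choice[S hS] k : exists M, forall N, \sum_(j < N) nc2 (c k j) <= M.
  by have [_ h] := hc k; exact: h.
(* This is [beta / (1 - beta)], the bound that the radial energies of the quotient must reach; the
   constant 1 is restored at the end. *)
pose G t := (1 - beta t)^-1 - 1.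
pose F k z := (B z *m invmx (A z)) 0 k.
have mG : measurable_fun T G.
  apply: measurable_funB; last exact: measurable_cst.
  by apply: (measurableT_comp (@measurable_inv R)); case: bmf_1beta.
have iG : mu.-integrable T (EFin \o G).
  apply: (@hardy_fatou_integrable _ n c F (\sum_k S k)) => //.
  - by move=> k; have [] := hc k.
  - by move=> N; apply: ler_sum => k _; exact: hS.
  - apply: ae_circleS ae_1beta => t [s0 s1].
    by rewrite /G subr_ge0 -invr1 lef_pV2 ?posrE// invr1.
  apply: ae_circleS (ae_circleI (ae_circleI Blim Alim) (ae_circleI ae_1beta hA)).
  move=> t [[hB hA'] [[s0 s1] hq]] e e0.
  set be := beta t in s0 s1 hq.
  have Gam m : 0 <= \sum_k nc2 (F k ((rad R m)%:C * expi t)).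
    by apply: sumr_ge0 => k _; exact: nc2_ge0.
  have GE : G t = be / (1 - be).
    by rewrite /G -/be; field; rewrite gt_eqF.
  have [be0|be_neq0] := eqVneq be 0.
    by exists 0%N => m _; rewrite GE be0 mul0r; apply: le_trans (Gam m); lra.
  have be0 : 0 < be by rewrite lt_neqAle eq_sym be_neq0 beta_ge0.
  pose x l := conjc (Bd t 0 l).
  pose zz m := (rad R m)%:C * expi t.
  have cp : cto (fun m => \sum_l B (zz m) 0 l * x l) be%:C.
    have -> : be%:C = \sum_l Bd t 0 l * x l.
      by rewrite /be /beta rmorph_sum; apply: eq_bigr => l _; rewrite nc2_conjM.
    apply: cto_sum => l _.
    by apply: ctoM (cto_cst _); exact: (radial_lim_cto (hB l)).
  have cq : \sum_k nc2 (\sum_l A (zz m) k l * x l) @[m --> \oo] -->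
      \sum_k nc2 (\sum_l Ad t k l * x l).
    apply: (@cvgr_sum R _ _ (fun k m => nc2 (\sum_l A (zz m) k l * x l))
      (fun k => nc2 (\sum_l Ad t k l * x l))) => k.
    apply: cto_nc2; apply: cto_sum => l _; apply: ctoM (cto_cst _).
    exact: (radial_lim_cto (hA' k l)).
  set q := \sum_k nc2 _ in hq cq.
  have q0 : 0 <= q by apply: sumr_ge0 => k _; exact: nc2_ge0.
  have := cto_nc2 cp; rewrite nc2_real => cp2.
  have [Ge|Ge] := leP (G t - e) 0.
    by exists 0%N => m _; exact: le_trans Ge (Gam m).
  have lim_gt0 : 0 < be ^+ 2 - (G t - e) * q.
    have : (G t - e) * q <= (G t - e) * (be * (1 - be)) by rewrite ler_wpM2l// ltW.
    have -> : (G t - e) * (be * (1 - be)) = be ^+ 2 - e * (be * (1 - be)).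
      by rewrite GE; field; rewrite gt_eqF.
    have : 0 < e * (be * (1 - be)) by rewrite !mulr_gt0.
    lra.
  have cd : nc2 (\sum_l B (zz m) 0 l * x l) -
      (G t - e) * \sum_k nc2 (\sum_l A (zz m) k l * x l) @[m --> \oo] -->
      be ^+ 2 - (G t - e) * q.
    by apply: cvgB cp2 _; exact: cvgMr.
  move/cvgrPdist_lt : cd => /(_ _ lim_gt0)[N _ hN]; exists N => m /hN.
  rewrite ltr_norml => /andP[_ h1].
  have h2 : nc2 (\sum_l B (zz m) 0 l * x l) <=
     (\sum_k nc2 (F k (zz m))) * \sum_k nc2 (\sum_l A (zz m) k l * x l).
    have -> : \sum_l B (zz m) 0 l * x l = \sum_k F k (zz m) * \sum_l A (zz m) k l * x l.
      have uA : A (zz m) \in unitmx by apply: (outer_unitmx outA Aal); exact: rad_circle.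
      rewrite -{1}[B (zz m)](mulmxKV uA).
      under eq_bigr do rewrite mxE mulr_suml.
      rewrite exchange_big/=; apply: eq_bigr => k _; rewrite mulr_sumr.
      by apply: eq_bigr => l _; rewrite mulrA.
    exact: nc2_sumM_le.
  rewrite leNgt; apply/negP => h3.
  have : (\sum_k nc2 (F k (zz m))) * \sum_k nc2 (\sum_l A (zz m) k l * x l) <=
     (G t - e) * \sum_k nc2 (\sum_l A (zz m) k l * x l).
    rewrite ler_wpM2r ?(ltW h3)//.
    by apply: sumr_ge0 => k _; exact: nc2_ge0.
  lra.
have := @integrableD _ _ R mu T (measurable_itv _) _ _ iG (bmf_integrable (bmf_cst 1)).
apply: eq_integrable; first exact: measurable_itv.
by move=> t _ /=; rewrite -EFinD /G subrK.
Qed.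

End Quotient.

End Boundary.

(* Uniform boundedness by a gliding hump with signs [f = \sum_j s_j 3^-j z^(m_j)]:
   each sign keeps the [j]-th functional large on the partial sum, and the
   remaining terms are too small to undo this. *)
Section UniformBound.
Variable R : realType.
Local Notation C := R[i].
Local Notation th := (3^-1 : R).

Lemma geo_third_tail J j : \sum_(i < j) th ^+ (J + i) <= 3 / 2 * th ^+ J.
Proof.
under eq_bigr do rewrite exprD.
rewrite -mulr_sumr mulrC ler_wpM2r ?exprn_ge0//.
have -> : 3 / 2 = (1 - th)^-1 by field.
by apply: geo_sum; lra.
Qed.

(** The supremum need not be attained; an index within a factor 3/2 of it serves as the hump. *)
Lemma near_sup (x : nat -> R) (M : R) m0 : 0 < x m0 -> (forall q, x q <= M) ->
  exists m, 2 / 3 * x m0 <= x m /\ forall q, x q <= 3 / 2 * x m.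
Proof.
move=> x0 xM; pose E := range x.
have hE : has_sup E by split; [exists (x m0), m0|exists M => _ [q _ <-]].
have ub q : x q <= sup E by apply: ub_le_sup; [exact: hE.2|exists q].
have s0 : 0 < sup E by exact: lt_le_trans x0 (ub m0).
have e0 : 0 < sup E / 3 by lra.
have [_ [m _ <-] hm] := sup_adherent e0 hE; exists m; split.
  by have := ub m0; lra.
by move=> q; have := ub q; lra.
Qed.

(** Since [2 d = (a + d) - (a - d)], one of the two has modulus at least [|d|]. *)
Lemma sign_choice (a d : C) : exists s : R, `|s| = 1 /\ nc d <= nc (a + s%:C * d).
Proof.
have [h|h] := leP (nc d) (nc (a + d)); first by exists 1; rewrite normr1 mul1r.
exists (-1); rewrite normrN1; split => //.
have := ncB (a + d) (a + (-1)%:C * d).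
have -> : a + d - (a + (-1)%:C * d) = (2 : R)%:C * d.
  by rewrite !raddfN/= rmorph1 rmorphMn/= rmorph1; ring.
rewrite ncM nc_real ger0_norm//; lra.
Qed.

Variables (n : nat) (B : C -> 'rV[C]_n).
Hypothesis HinfB : forall f, Hinf f -> inHB B f.

Let data := {m : nat & (('I_m -> C) * ('I_m -> C))%type}.
Let lam (D : data) : 'I_(tag D) -> C := (tagged D).1.
Let cc (D : data) : 'I_(tag D) -> C := (tagged D).2.
Arguments lam : clear implicits.
Arguments cc : clear implicits.
Let ev (D : data) (f : C -> C) : C := \sum_i conjc (cc D i) * f (lam D i).
Let Q (D : data) : R := kform B (lam D) (cc D).
Let ok (D : data) := forall i, inD (lam D i).

Let ev_X D q : nc (ev D (fun z => z ^+ q)) = nc (kcoef (lam D) (cc D) q).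
Proof.
rewrite -[RHS]nc_conj /kcoef conjc_sum; congr nc; apply: eq_bigr => i _.
by rewrite rmorphM rmorphXn/= conjcK.
Qed.

Let Hinf_poly (p : {poly C}) : Hinf (horner p).
Proof.
split; first by eexists; exact: ps_poly.
by exists (\sum_(j < size p) nc p`_j) => z zD; apply: horner_disc_le; exact: ltW.
Qed.

(** Positivity is read off the hypothesis: the constant 1 lies in [H(B)] with a bound [M], nonzero
    by a test at the node 0, so [0 <= M^2 Q]. *)
Let Q_ge0 D : ok D -> 0 <= Q D.
Proof.
move=> okD; have [M hM] := HinfB (Hinf_poly 1).
have M0 : 0 < M ^+ 2.
  rewrite lt_neqAle sqr_ge0 andbT eq_sym; apply/eqP => M0.
  have D0 (i : 'I_1) : inD (0 : C) by rewrite /inD nc0.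
  have := hM 1%N (fun=> 0) (fun=> 1) D0.
  rewrite M0 mul0r big_ord_recl big_ord0 addr0 hornerC conjc1 mulr1 -nc_sqr nc1 expr1n.
  by rewrite ler10.
have := le_trans (nc2_ge0 _) (hM _ _ (cc D) okD).
by rewrite pmulr_rge0.
Qed.

Lemma monomials_bounded : exists M : R, forall m, inHB_le B (fun z => z ^+ m) M.
Proof.
apply: contrapT => /forallNP hM.
have /choice[d hd] : forall j : nat, exists d : data * nat, [/\ ok d.1,
    (forall q, nc (kcoef (lam d.1) (cc d.1) q) <= 3 / 2 * nc (kcoef (lam d.1) (cc d.1) d.2)) &
    16 * (9 ^+ j * j.+1%:R ^+ 2 * Q d.1) < nc2 (kcoef (lam d.1) (cc d.1) d.2)].
  (* The near-maximal exponent keeps [(2/3)^2] of the factor [6^2]. The 16 that remains offsets the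
     square of the 1/4 surviving in [low]. *)
  move=> j; have /existsNP[m] := hM (3 ^+ j * 6 * j.+1%:R).
  move=> /existsNP[N] /existsNP[l] /existsNP[c] /not_implyP[lD].
  move=> /negP; rewrite -ltNge => h.
  pose D : data := existT _ N (l, c).
  have okD : ok D by [].
  have hQ := Q_ge0 okD.
  have hm : (3 ^+ j * 6 * j.+1%:R) ^+ 2 * Q D < nc2 (kcoef l c m).
    apply: lt_le_trans h _.
    by rewrite -[leRHS]nc_sqr -(ev_X D m) nc_sqr.
  have m0 : 0 < nc (kcoef l c m).
    rewrite lt_neqAle nc_ge0 andbT eq_sym; apply/eqP => m0.
    by move: hm; rewrite -nc_sqr m0 expr0n ltNge mulr_ge0 ?sqr_ge0.
  have [p [hp1 hp2]] := near_sup m0 (fun q => kcoef_le c q lD).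
  exists (D, p); split => //.
  have : (2 / 3 * nc (kcoef l c m)) ^+ 2 <= nc (kcoef l c p) ^+ 2.
    by rewrite lerXn2r ?nnegrE ?mulr_ge0 ?nc_ge0.
  rewrite [leRHS]nc_sqr exprMn nc_sqr; apply: lt_le_trans.
  have -> : 16 * (9 ^+ j * j.+1%:R ^+ 2 * Q D) =
      (2 / 3) ^+ 2 * ((3 ^+ j * 6 * j.+1%:R) ^+ 2 * Q D).
    have -> : (9 : R) ^+ j = 3 ^+ j * 3 ^+ j by rewrite -exprMn; congr (_ ^+ _); ring.
    by field.
  by rewrite ltr_pM2l//; lra.
pose D j := (d j).1; pose m j := (d j).2.
pose k j q := kcoef (lam (D j)) (cc (D j)) q.
have okD j : ok (D j) by have [] := hd j.
have kmax j q : nc (k j q) <= 3 / 2 * nc (k j (m j)) by have [_ h _] := hd j; exact: h.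
have kbig j : 16 * (9 ^+ j * j.+1%:R ^+ 2 * Q (D j)) < nc2 (k j (m j)) by have [] := hd j.
have /choice[sg hsg] : forall jp : nat * {poly C}, exists s : R, `|s| = 1 /\
    nc ((th ^+ jp.1)%:C * ev (D jp.1) (fun z => z ^+ m jp.1)) <=
    nc (ev (D jp.1) (horner jp.2) + s%:C * ((th ^+ jp.1)%:C * ev (D jp.1) (fun z => z ^+ m jp.1))).
  by move=> jp; exact: sign_choice.
(* Each sign depends on the partial sum already built, hence [sg] takes the pair. *)
pose fix X j : {poly C} := if j is j'.+1 then
  X j' + (sg (j', X j') * th ^+ j')%:C *: 'X^(m j') else 0.
pose s j := sg (j, X j) * th ^+ j.
have ns j : nc (s j)%:C = th ^+ j.
  by rewrite nc_real normrM (hsg (j, X j)).1 mul1r ger0_norm// exprn_ge0.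
have XE j : X j = \sum_(i < j) (s i)%:C *: 'X^(m i).
  by elim: j => [|j IH]; [rewrite big_ord0|rewrite big_ord_recr/= -IH].
have Xz j z : (X j).[z] = \sum_(i < j) (s i)%:C * z ^+ m i.
  by rewrite XE horner_sum; apply: eq_bigr => i _; rewrite hornerZ hornerXn.
have Xq j q : (X j)`_q = \sum_(i < j) (s i)%:C * (q == m i)%:R.
  by rewrite XE coef_sum; apply: eq_bigr => i _; rewrite coefZ coefXn.
have cgeo : cvgn (series (fun i => th ^+ i)).
  have := @is_cvg_geometric_series R 1 th; rewrite ger0_norm// => /(_ _).
  have -> : geometric 1 th = (fun i => th ^+ i) by apply/funext => i; rewrite /= mul1r.
  by apply; lra.
(* The exponents [m i] may repeat, so a coefficient of the limit is itself a series. *)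
have /choice[x hx] q : exists l, cto (fun j => (X j)`_q) l.
  have [|l hl] := csum_cvg (u := fun i => (s i)%:C * (q == m i)%:R) _ cgeo.
    by move=> i; rewrite ncM ns; case: (q == m i); rewrite ?nc1 ?nc0 ?mulr1 ?mulr0 ?exprn_ge0.
  by exists l; apply: cto_ext hl; exists 0%N => j _; rewrite Xq.
have /choice[f hf] z : exists l, inD z -> cto (fun j => (X j).[z]) l.
  have [zD|] := pselect (inD z); last by exists 0.
  have [|l hl] := csum_cvg (u := fun i => (s i)%:C * z ^+ m i) _ cgeo.
    by move=> i; rewrite ncM ns ncX ler_piMr ?exprn_ge0// exprn_ile1 ?nc_ge0// ltW.
  by exists l => _; apply: cto_ext hl; exists 0%N => j _; rewrite Xz.
have Xdiff J j z : (X (J + j)).[z] - (X J).[z] = \sum_(i < j) (s (J + i)%N)%:C * z ^+ m (J + i)%N.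
  by rewrite !Xz big_split_ord/= addrAC subrr add0r.
have fX J z : inD z -> nc (f z - (X J).[z]) <= 3 / 2 * th ^+ J.
  move=> zD; have := ctoB (cto_subseq (s := addn J) (leq_addl J) (hf z zD)) (cto_cst (X J).[z]).
  move/cto_nc_le; apply => j /=; rewrite Xdiff; apply: le_trans (nc_sum _ _ _) _.
  apply: le_trans (geo_third_tail J j); apply: ler_sum => i _.
  by rewrite ncM ns ncX ler_piMr ?exprn_ge0// exprn_ile1 ?nc_ge0// ltW.
have xX J N : \sum_(q < N) nc (x q - (X J)`_q) <= 3 / 2 * th ^+ J.
  have h : \sum_(q < N) nc ((X (J + j))`_q - (X J)`_q) @[j --> \oo] -->
      \sum_(q < N) nc (x q - (X J)`_q).
    apply: (@cvgr_sum R _ _ (fun (q : 'I_N) j => nc ((X (J + j))`_q - (X J)`_q))) => q.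
    apply: cto_nc; apply: ctoB (cto_cst _).
    exact: (cto_subseq (s := addn J) (leq_addl J) (hx q)).
  rewrite -(cvg_lim _ h)//; apply: limr_le; first by apply/cvg_ex; eexists; exact: h.
  apply: nearW => j; apply: le_trans (geo_third_tail J j).
  apply: (@le_trans _ _ (\sum_(q < N) \sum_(i < j) th ^+ (J + i) * ((q : nat) == m (J + i)%N)%:R)).
    apply: ler_sum => q _; rewrite !Xq big_split_ord/= addrAC subrr add0r.
    apply: le_trans (nc_sum _ _ _) _; apply: ler_sum => i _; rewrite ncM ns.
    by case: (_ == _); rewrite ?nc1 ?nc0.
  rewrite exchange_big/=; apply: ler_sum => i _; rewrite -mulr_sumr ler_piMr ?exprn_ge0//.
  have [mN|Nm] := ltnP (m (J + i)%N) N; last first.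
    rewrite big1// => q _; case: eqP => // qm.
    by have := ltn_ord q; rewrite qm ltnNge Nm.
  rewrite (bigD1 (Ordinal mN))//= eqxx big1 ?addr0// => q qm.
  case: eqP => // e; case/eqP: qm; exact/val_inj.
have th0 : (fun J => 3 * th ^+ J) @ \oo --> (0 : R).
  by rewrite -[X in _ --> X](mulr0 3); apply: cvgMr; apply: expr_cvg0; lra.
(* Past the size of [X J], a partial sum of [x] and the value of [f] both lie within [3/2 * th ^+ J]
   of [X J]. *)
have xf : ps_rep x f.
  move=> z zD e e0; move/cvgrPdist_lt : th0 => /(_ _ e0)[J _ /(_ J (leqnn J))].
  rewrite sub0r normrN ger0_norm ?mulr_ge0 ?exprn_ge0// => hJ.
  exists (size (X J)) => N sN; apply: le_lt_trans hJ.
  have -> : \sum_(q < N) x q * z ^+ q - f z =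
      \sum_(q < N) (x q - (X J)`_q) * z ^+ q - (f z - (X J).[z]).
    rewrite (horner_coef_wide _ sN); under [X in _ = X - _]eq_bigr do rewrite mulrBl.
    by rewrite sumrB; ring.
  apply: le_trans (ncB _ _) _; rewrite (_ : 3 * _ = 3 / 2 * th ^+ J + 3 / 2 * th ^+ J); last by field.
  apply: lerD; last exact: fX.
  apply: le_trans (nc_sum _ _ _) _; apply: le_trans (xX J N); apply: ler_sum => q _.
  by rewrite ncM ncX ler_piMr ?nc_ge0// exprn_ile1 ?nc_ge0// ltW.
have /HinfB[M hMf] : Hinf f.
  split; first by exists x.
  by exists (3 / 2 * th ^+ 0) => z zD; have := fX 0%N z zD; rewrite horner0 subr0.
have evc J : cto (fun j => ev (D J) (horner (X (J.+1 + j)))) (ev (D J) f).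
  apply: cto_sum => i _; apply: ctoZ.
  exact: (cto_subseq (s := addn J.+1) (leq_addl J.+1) (hf _ (okD J i))).
(* The sign secures [th ^+ J] times [|k|]; later terms take away at most [3/2 * 3/2 * th ^+ J.+1],
   that is [3/4 * th ^+ J], times [|k|]. *)
have low J : th ^+ J * nc (k J (m J)) / 4 <= nc (ev (D J) f).
  have e1 : th ^+ J * nc (k J (m J)) <= nc (ev (D J) (horner (X J.+1))).
    have := (hsg (J, X J)).2; rewrite /= ncM ev_X nc_real ger0_norm ?exprn_ge0//.
    rewrite -/(k J (m J)); set y := nc (_ + _) => h; apply: le_trans h _.
    rewrite le_eqVlt; apply/orP; left; apply/eqP; congr nc.
    rewrite {2}/ev; under [RHS]eq_bigr do rewrite hornerD hornerZ hornerXn mulrDr.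
    rewrite big_split/=; congr (_ + _); rewrite mulrA -rmorphM/= mulr_sumr.
    by apply: eq_bigr => i _; rewrite mulrCA.
  have := cto_nc (evc J) => h; rewrite -(cvg_lim _ h)//.
  apply: limr_ge; first by apply/cvg_ex; eexists; exact: h.
  apply: nearW => j.
  have e2 : nc (ev (D J) (horner (X (J.+1 + j))) - ev (D J) (horner (X J.+1))) <=
      3 / 4 * (th ^+ J * nc (k J (m J))).
    have -> : ev (D J) (horner (X (J.+1 + j))) - ev (D J) (horner (X J.+1)) =
        \sum_(i < j) (s (J.+1 + i)%N)%:C * ev (D J) (fun z => z ^+ m (J.+1 + i)%N).
      rewrite /ev -sumrB; under eq_bigr do rewrite -mulrBr Xdiff mulr_sumr.
      rewrite exchange_big/=; apply: eq_bigr => i _; rewrite mulr_sumr.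
      by apply: eq_bigr => l _; rewrite mulrCA.
    apply: le_trans (nc_sum _ _ _) _.
    apply: (@le_trans _ _ (\sum_(i < j) th ^+ (J.+1 + i) * (3 / 2 * nc (k J (m J))))).
      apply: ler_sum => i _; rewrite ncM ns ler_wpM2l ?exprn_ge0// ev_X.
      exact: kmax.
    rewrite -mulr_suml; apply: le_trans (ler_wpM2r _ (geo_third_tail J.+1 j)) _.
      by rewrite mulr_ge0 ?nc_ge0.
    by rewrite exprS le_eqVlt; apply/orP; left; apply/eqP; field.
  have := ncB (ev (D J) (horner (X (J.+1 + j))))
    (ev (D J) (horner (X (J.+1 + j))) - ev (D J) (horner (X J.+1))).
  rewrite opprB addrC subrK => e3; lra.
have contra J : J.+1%:R ^+ 2 < M ^+ 2.
  have hQ := Q_ge0 (okD J).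
  have h1 : nc2 (ev (D J) f) <= M ^+ 2 * Q (D J) := hMf _ _ (cc (D J)) (okD J).
  have h2 : (th ^+ J * nc (k J (m J)) / 4) ^+ 2 <= nc2 (ev (D J) f).
    rewrite -nc_sqr lerXn2r ?nnegrE ?nc_ge0//.
    by rewrite divr_ge0// mulr_ge0 ?exprn_ge0 ?nc_ge0.
  have h3 := le_trans h2 h1.
  have e9 : (th ^+ J) ^+ 2 * 9 ^+ J = 1.
    rewrite -exprM mulnC exprM -exprMn (_ : th ^+ 2 * 9 = 1) ?expr1n//; by field.
  have h4 : J.+1%:R ^+ 2 * Q (D J) < M ^+ 2 * Q (D J).
    apply: lt_le_trans h3; rewrite !exprMn nc_sqr.
    have t0 : 0 < (th ^+ J) ^+ 2 by rewrite !exprn_gt0//; lra.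
    have := kbig J; rewrite -(ltr_pM2l t0).
    have -> : (th ^+ J) ^+ 2 * (16 * (9 ^+ J * J.+1%:R ^+ 2 * Q (D J))) =
       16 * ((th ^+ J) ^+ 2 * 9 ^+ J) * (J.+1%:R ^+ 2 * Q (D J)) by ring.
    rewrite e9 mulr1 => h4.
    rewrite (_ : (4^-1 : R) ^+ 2 = 16^-1); last by field.
    by rewrite ltr_pdivlMr// mulrC.
  have Q0 : 0 < Q (D J).
    rewrite lt_neqAle hQ andbT; apply/eqP => Q0.
    by move: h4; rewrite -Q0 !mulr0 ltxx.
  by move: h4; rewrite ltr_pM2r.
have := contra (Num.bound `|M|); rewrite ltNge -(real_normK (num_real M)) => /negP; apply.
rewrite lerXn2r ?nnegrE//; apply: le_trans (ltW (archi_boundP (normr_ge0 M))) _.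
by rewrite ler_nat.
Qed.

End UniformBound.

(** * The circle identities for [A] and [a I], and the cycle of implications *)

Lemma isometry_energy (R : realType) (n : nat) (b : 'rV[R[i]]_n) (A : 'M[R[i]]_n)
  (x : 'I_n -> R[i]) :
  (map_mx conjc b)^T *m b + (map_mx conjc A)^T *m A = 1%:M ->
  \sum_k nc2 (\sum_l A k l * x l) = \sum_l nc2 (x l) - nc2 (\sum_l b 0 l * x l).
Proof.
move=> /matrixP h; apply/eqP; rewrite eq_sym subr_eq; apply/eqP; apply: complexI.
rewrite rmorphD/= !rmorph_sum/=.
have nc2_sum (y : 'I_n -> R[i]) : (nc2 (\sum_l y l * x l))%:C =
    \sum_i \sum_j conjc (x i) * x j * (conjc (y i) * y j).
  rewrite -nc2_conjM mulrC conjc_sum mulr_suml; apply: eq_bigr => i _.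
  by rewrite mulr_sumr; apply: eq_bigr => j _; rewrite rmorphM/=; ring.
rewrite nc2_sum (eq_bigr _ (fun k _ => nc2_sum (A k))) exchange_big/=.
rewrite -big_split/=; apply: eq_bigr => i _.
rewrite exchange_big/= -big_split/= (bigD1 i)//= [X in _ + X]big1 ?addr0.
  rewrite -mulr_sumr -mulrDr; have := h i i.
  rewrite !mxE big_ord1 !mxE eqxx => e.
  rewrite [X in _ * X](_ : _ = 1) ?mulr1; first by rewrite mulrC nc2_conjM.
  rewrite addrC; apply: etrans e; congr (_ + _).
  by apply: eq_bigr => k _; rewrite !mxE.
move=> j ji; rewrite -mulr_sumr -mulrDr; have := h i j.
rewrite !mxE big_ord1 !mxE eq_sym (negbTE ji) => e.
rewrite [X in _ * X](_ : _ = 0) ?mulr0//.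
rewrite addrC; apply: etrans e; congr (_ + _); by apply: eq_bigr => k _; rewrite !mxE.
Qed.

(** Coordinates are approximated separately, each with the share [e / n] of the error. *)
Lemma scalar_mx_outer (R : realType) (n : nat) (a : R[i] -> R[i]) :
  (0 < n)%N -> outer_scalar a -> outer_mx (fun z => (a z)%:M : 'M[R[i]]_n).
Proof.
move=> n0 [Ha Hd]; split.
  move=> i j; have [->|ij] := eqVneq i j.
    by under eq_fun do rewrite mxE eqxx mulr1n.
  under eq_fun do rewrite mxE (negbTE ij) mulr0n.
  split; last by exists 0 => z _; rewrite nc0.
  exists (monc 0 0); apply: ps_ext (ps_monc 0 0) => z _; by rewrite mul0r.
move=> g hg e e0.
have e0' : 0 < e / n%:R by rewrite divr_gt0 ?ltr0n.
have /choice[pc h] k : exists pc : {poly R[i]} * (nat -> R[i]),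
    ps_rep pc.2 (fun z => a z * pc.1.[z]) /\
    forall N, \sum_(j < N) nc2 (pc.2 j - g k j) <= e / n%:R.
  by have [p [c hc]] := Hd (g k) (hg k) _ e0'; exists (p, c).
exists (fun k => (pc k).1), (fun k => (pc k).2); split.
  move=> k; apply: ps_ext (h k).1 => z _.
  by rewrite mul_scalar_mx !mxE.
move=> N; apply: (@le_trans _ _ (\sum_(k < n) e / n%:R)).
  by apply: ler_sum => k _; exact: (h k).2.
by rewrite sumr_const card_ord -[leLHS]mulr_natr divfK// pnatr_eq0 -lt0n.
Qed.

Theorem theorem4p1 (R : realType) (n : nat) (hn : (0 < n)%N)
  (B : R[i] -> 'rV[R[i]]_n) (a : R[i] -> R[i]) (A : R[i] -> 'M[R[i]]_n)
  (Bb : R -> 'rV[R[i]]_n) (ab : R -> R[i]) (Ab : R -> 'M[R[i]]_n) :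
  schur_row B ->
  (* boundary values of B, a, A on T (parametrised by t in [0, 2 pi]) *)
  (forall k, measurable_fun `[0, 2 * pi]%classic (fun t => complex.Re (Bb t 0 k))) ->
  (forall k, measurable_fun `[0, 2 * pi]%classic (fun t => complex.Im (Bb t 0 k))) ->
  {ae (@lebesgue_measure R), forall t, t \in `[0, 2 * pi] ->
     forall k, radial_lim (fun z => B z 0 k) t (Bb t 0 k)} ->
  {ae (@lebesgue_measure R), forall t, t \in `[0, 2 * pi] ->
     radial_lim a t (ab t)} ->
  {ae (@lebesgue_measure R), forall t, t \in `[0, 2 * pi] ->
     forall i j, radial_lim (fun z => A z i j) t (Ab t i j)} ->
  (* log (1 - B B^* ) in L^1(T) *)
  {ae (@lebesgue_measure R), forall t, t \in `[0, 2 * pi] ->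
     0 < 1 - \sum_(k < n) nc2 (Bb t 0 k)} ->
  (@lebesgue_measure R).-integrable `[0, 2 * pi]%classic
     (fun t => (ln (1 - \sum_(k < n) nc2 (Bb t 0 k)))%:E) ->
  (* a in S(C,C), outer, with sum |b_j|^2 + |a|^2 = 1 a.e. on T *)
  schur_scalar a -> outer_scalar a ->
  {ae (@lebesgue_measure R), forall t, t \in `[0, 2 * pi] ->
     \sum_(k < n) nc2 (Bb t 0 k) + nc2 (ab t) = 1} ->
  (* A outer with B^* B + A^* A = I a.e. on T *)
  outer_mx A ->
  {ae (@lebesgue_measure R), forall t, t \in `[0, 2 * pi] ->
     (map_mx conjc (Bb t))^T *m Bb t + (map_mx conjc (Ab t))^T *m Ab t = 1%:M} ->
  [<-> (* (i) *) (forall f, Hinf f -> inHB B f);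
       (* (ii) *) (exists M : R, forall m : nat, inHB_le B (fun z => z ^+ m) M);
       (* (iii) *) (forall k, H2 (fun z => (B z *m invmx (A z)) 0 k));
       (* (iv) *) (forall k, H2 (fun z => B z 0 k / a z));
       (* (v) *) (@lebesgue_measure R).-integrable `[0, 2 * pi]%classic
                   (fun t => ((1 - \sum_(k < n) nc2 (Bb t 0 k))^-1)%:E)].

Proof.
move=> hB mRe mIm Blim alim Alim Blt1 _ [_ _] oa hab oA hAB.
have [b Bb_ps] := choice hB.1.
have /choice[al Aal] i : exists al, forall j, ps_rep (al j) (fun z => A z i j).
  have h j : exists c, ps_rep c (fun z => A z i j) by have [] := oA.1 i j.
  by have [c hc] := choice h; exists c.
have [[[ac aac] _] _] := oa.
have oa' := scalar_mx_outer hn oa.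
pose al' (i j : 'I_n) := if i == j then ac else monc 0 0.
have aal' i j : ps_rep (al' i j) (fun z => ((a z)%:M : 'M[R[i]]_n) i j).
  rewrite /al'; under eq_fun do rewrite mxE; case: (i == j).
    exact: aac.
  by apply: ps_ext (ps_monc 0 0) => z _; rewrite mul0r.
have alim' : ae_circle (fun t => forall i j,
    radial_lim (fun z => ((a z)%:M : 'M[R[i]]_n) i j) t (((ab t)%:M : 'M[R[i]]_n) i j)).
  apply: ae_circleS alim => t h i j; under eq_fun do rewrite mxE; rewrite mxE.
  case: (i == j); first exact: h.
  move=> e e0; exists 1; split => // r _ _.
  by rewrite subrr nc0.
have scal t x k : \sum_l ((ab t)%:M : 'M[R[i]]_n) k l * x l = ab t * x k.
  rewrite (bigD1 k)//= mxE eqxx mulr1n big1 ?addr0// => l lk.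
  by rewrite mxE eq_sym (negbTE lk) mulr0n mul0r.
have energy_a : ae_circle (fun t => forall x,
    \sum_k nc2 (\sum_l ((ab t)%:M : 'M[R[i]]_n) k l * x l) = (1 - beta Bb t) * \sum_l nc2 (x l)).
  apply: ae_circleS hab => t h x; rewrite mulr_sumr; apply: eq_bigr => k _.
  by rewrite scal nc2M /beta -h addrC addKr.
have energy_A : ae_circle (fun t => forall x : 'I_n -> R[i],
    \sum_k nc2 (\sum_l Ab t k l * x l) = \sum_l nc2 (x l) - nc2 (\sum_l Bb t 0 l * x l)).
  by apply: ae_circleS hAB => t h x; exact: isometry_energy.
have conjB t : \sum_l nc2 (conjc (Bb t 0 l)) = beta Bb t.
  by apply: eq_bigr => l _; rewrite nc2_conj.
have BconjB t : nc2 (\sum_l Bb t 0 l * conjc (Bb t 0 l)) = beta Bb t ^+ 2.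
  rewrite -nc2_real; congr nc2; rewrite rmorph_sum.
  by apply: eq_bigr => l _; rewrite nc2_conjM.
(* An equality at every [z]: where [a z = 0], both quotients are 0 by convention. *)
have quo_a : (fun k => H2 (fun z => (B z *m invmx ((a z)%:M : 'M[R[i]]_n)) 0 k)) =
             (fun k => H2 (fun z => B z 0 k / a z)).
  apply/funext => k; congr H2; apply/funext => z.
  by rewrite invmx_scalar mul_mx_scalar mxE mulrC.
tfae.
- exact: monomials_bounded.
- move=> [M hM]; apply: (monomials_quotient_H2 hB Bb_ps mRe mIm Blim Blt1 oA Aal Alim _ hM).
  by apply: ae_circleS energy_A => t h x; rewrite h.
(* This link of the cycle passes through integrability of the weight: at [x = conj B] the isometry
   gives [|A x|^2 = beta - beta^2], and the weight then yields the quotient by [a I]. *)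
- move=> h3.
  have iV : (@lebesgue_measure R).-integrable `[0, 2 * pi]%classic
      (EFin \o (fun t => (1 - beta Bb t)^-1)).
    apply: (quotient_H2_integrable mRe mIm Blim Blt1 oA Aal Alim _ h3).
    apply: ae_circleS energy_A => t h; rewrite h conjB BconjB.
    by rewrite mulrBr mulr1 expr2.
  move=> k; have := integrable_quotient_H2 hB Bb_ps mRe mIm Blim Blt1 oa' aal' alim' _ iV.
  rewrite -[H2 _]/((fun k => H2 (fun z => B z 0 k / a z)) k) -quo_a; apply.
  by apply: ae_circleS energy_a => t h x; rewrite h.
- move=> h4; apply: (quotient_H2_integrable mRe mIm Blim Blt1 oa' aal' alim').
    apply: ae_circleS energy_a => t h; rewrite h conjB mulrC lexx//.
  by move=> k; rewrite -[H2 _]/((fun k => H2 (fun z => (B z *m invmx ((a z)%:M : 'M[R[i]]_n)) 0 k)) k) quo_a.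
- move=> iV f [[fc hf] [F hF]].
  pose V := cmean (fun t => (1 - beta Bb t)^-1).
  have V0 : 0 <= V by exact: cmean_inv_1beta_ge0.
  (* [inHB_le] squares its bound, and [kform_ge] supplies [F^2 V]. *)
  exists (F * Num.sqrt V) => m lam cc hl; rewrite exprMn sqr_sqrtr//.
  exact: (kform_ge hB Bb_ps mRe mIm Blim Blt1 cc iV hl hf hF).
Qed.
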